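(* Let $f\in\mathcal U(1)$ and $a_2=f''(0)/2$. Then $$\operatorname{Re}\sqrt{\frac{f(z)}{z}}>\alpha(|a_2|)\qquad\text{for } z\in\mathbb D,$$ where the square root is the branch equal to $1$ at $z=0$ and $$\alpha(x)=\frac{20+x-\sqrt{x^2+40x+16}}{24},\qquad 0\le x\le 2.$$
   Context: $\mathbb D=\{z\in\mathbb C:|z|<1\}$. $\mathcal A$ is the class of functions $f$ analytic in $\mathbb D$ with $f(z)=z+\sum_{k\ge2}a_kz^k$. For $f\in\mathcal A$ with $f(z)\ne0$ for $z\in\mathbb D\setminus\{0\}$, set $U_f(z)=\left(\frac{z}{f(z)}\right)^2f'(z)-1$. $\mathcal U(1)$ is the class of such $f\in\mathcal A$ with $|U_f(z)|<1$ for all $z\in\mathbb D$ (for such $f$ one has $|a_2|\le 2$ and $f(z)/z\ne0$ in $\mathbb D$). *)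

(* Defs.v *)
From Stdlib Require Import Reals.
From Coquelicot Require Import Coquelicot.
Open Scope C_scope.

Definition in_disk (z : C) : Prop := (Cmod z < 1)%R.

Definition has_cderiv (f : C -> C) (z d : C) : Prop :=
  @is_derive C_AbsRing C_NormedModule f z d.

Definition classA (f : C -> C) (a : nat -> C) : Prop :=
  a 0%nat = 0 /\ a 1%nat = 1 /\
  forall z, in_disk z -> @is_pseries C_AbsRing C_NormedModule a z (f z).

Definition U_f (f : C -> C) (z d : C) : C := (z / f z) * (z / f z) * d - 1.

(* f in U(1): f(z) <> 0 on D \ {0}, and |U_f(z)| < 1 on D.
   At z = 0, U_f(0) = 0 holds automatically (removable singularity,
   f'(0) = 1), so the condition is imposed for z <> 0. *)
Definition classU1 (f : C -> C) (a : nat -> C) : Prop :=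
  classA f a /\
  (forall z, in_disk z -> z <> 0 -> f z <> 0) /\
  (forall z, in_disk z -> z <> 0 ->
     exists d, has_cderiv f z d /\ (Cmod (U_f f z d) < 1)%R).

Definition alpha (x : R) : R := ((20 + x - sqrt (x * x + 40 * x + 16)) / 24)%R.

(* Main.v *)
Require Import Defs.
From Stdlib Require Import Reals Lra Lia ClassicalEpsilon.
From Coquelicot Require Import Coquelicot.
Open Scope C_scope.

(** Put [b = 2 alpha - 1], so that [Re g > alpha] says that [w = (g - 1) / (g - b)] satisfies
    [|w| < 1].  If this fails, let [z0] be a point of least modulus with [|w z0| = 1].
    By Jack's argument [k = z0 w'(z0) / w(z0)] is real, and the Schwarz-Pick lemma on
    [|z| < |z0|], which takes [w'(0) = a_2 / (2 (1 - b))] into account, improves the usual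
    [k >= 1] to [k >= (1 + b) / (1 - b)]; [alpha] is the number for which this is exactly what
    is needed to conclude [|U_f(z0)| >= 1].
    The complex analysis is elementary: a function with second-order expansions obeys the
    maximum principle, since the average of [|F|^2 + eps |z|^2] over four points
    [z0 + t u], [u^4 = 1], exceeds its value at [z0]. *)

(** * Second-order expansions *)

(** With [g = (1 - b w) / (1 - w)] and [z w' = k w], the relation [f = z g^2] gives
    [U_f = (g + 2 z g') / g^3 - 1], a rational function of [w] and [k]. The threshold for [k] is
    dictated by [w = -1], where [|U_f| = 1] for [k = (1 + b) / (1 - b)]. Schwarz-Pick bounds [|w|]
    by [t (t + c) / (1 + c t)] with [t = |z| / |z0|] and [c >= |z0| |w'(0)|]. The derivative of this
    bound at [t = 1] is [2 / (1 + c)], so the threshold is reached with [c = (1 - 3 b) / (1 + b)].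
    As [|z0| < 1], it is enough that [|a_2| / (2 (1 - b)) <= c]; equality here is the quadratic
    equation that defines alpha. The bound [|w| <= 1] is known only for [|z| <= |z0|], so the facts
    about [w'(z0)] are drawn from one-sided derivatives of [|w|] along directions pointing into that
    disk: straight to the centre for the lower bound on [k], nearly tangential for its realness. *)

Lemma locally_Cmod (z : C) (P : C -> Prop) :
  locally z P <-> exists del, (0 < del)%R /\ forall y, (Cmod (y - z) < del)%R -> P y.
Proof.
  rewrite locally_C; split.
  - intros [d Hd]; exists d; split; [apply cond_pos |].
    intros y Hy; apply Hd; exact Hy.
  - intros [d [Hd H]]; exists (mkposreal d Hd).
    intros y Hy; apply H; exact Hy.
Qed.

Lemma continuous_Cmod (F : C -> C) (z : C) :
  continuous F z <->
  forall eps, (0 < eps)%R ->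
    exists del, (0 < del)%R /\ forall y, (Cmod (y - z) < del)%R -> (Cmod (F y - F z) < eps)%R.
Proof.
  split.
  - intros H eps He.
    apply (locally_Cmod z (fun y => Cmod (F y - F z) < eps)%R).
    apply (H (fun u => Cmod (u - F z) < eps)%R).
    apply locally_Cmod; exists eps; auto.
  - intros H P HP.
    apply locally_Cmod in HP; destruct HP as [e [He HP]].
    destruct (H e He) as [d [Hd H1]].
    apply (proj2 (locally_Cmod z (fun y => P (F y)))).
    exists d; split; [exact Hd |]; intros y Hy; apply HP, H1, Hy.
Qed.

Lemma continuous_Cplus (F G : C -> C) (z : C) :
  continuous F z -> continuous G z -> continuous (fun y => F y + G y) z.
Proof. exact (continuous_plus (V := C_NormedModule) F G z). Qed.

Lemma continuous_Cmult (F G : C -> C) (z : C) :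
  continuous F z -> continuous G z -> continuous (fun y => F y * G y) z.
Proof.
  intros HF HG.
  apply (continuous_scal (K := C_AbsRing) (V := C_NormedModule) F G z); [| exact HG].
  (* The scalar factor of [continuous_scal] carries the uniform structure of the absolute value;
     [locally_C] identifies its neighbourhoods with those of [HF]. *)
  intros P HP; apply HF, locally_C, HP.
Qed.

Lemma continuous_Cinv (F : C -> C) (z : C) :
  continuous F z -> F z <> 0 -> continuous (fun y => / F y) z.
Proof.
  intros HF Hz; apply continuous_Cmod; intros eps He.
  assert (HA : (0 < Cmod (F z))%R) by now apply Cmod_gt_0.
  set (A := Cmod (F z)) in *.
  assert (HAA : (0 < A * A)%R) by now apply Rmult_lt_0_compat.
  (* The first bound keeps [|F y|] above [A / 2]; the second then makes [|F y - F z| / (|F y| A)]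
     smaller than [eps]. *)
  destruct (proj1 (continuous_Cmod F z) HF (Rmin (A / 2) (eps * (A * A / 2))))
    as [d [Hd H]].
  { apply Rmin_pos; [lra |]. apply Rmult_lt_0_compat; lra. }
  exists d; split; [exact Hd |]; intros y Hy; specialize (H y Hy).
  assert (H1 := Rlt_le_trans _ _ _ H (Rmin_l _ _)).
  assert (H2 := Rlt_le_trans _ _ _ H (Rmin_r _ _)).
  assert (HB : (A / 2 < Cmod (F y))%R).
  { assert (T := Cmod_triangle (F y) (- (F y - F z))).
    replace (F y + - (F y - F z)) with (F z) in T by ring.
    rewrite Cmod_opp in T; fold A in T; lra. }
  assert (Hy0 : F y <> 0) by (apply Cmod_gt_0; lra).
  replace (/ F y - / F z) with (- (F y - F z) / (F y * F z)) by now field.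
  rewrite Cmod_div by now apply Cmult_neq_0.
  rewrite Cmod_opp, Cmod_mult; fold A.
  apply (Rmult_lt_reg_r (Cmod (F y) * A)); [apply Rmult_lt_0_compat; lra |].
  unfold Rdiv; rewrite Rmult_assoc, Rinv_l, Rmult_1_r by (apply Rgt_not_eq, Rmult_lt_0_compat; lra).
  apply (Rlt_le_trans _ _ _ H2), Rmult_le_compat_l; nra.
Qed.

(* [ring] and [field] do not see through [UniformSpace.sort C_UniformSpace]. *)
Ltac Ceq := cbv beta; try match goal with z : UniformSpace.sort _ |- _ => change C in z end;
  match goal with |- @eq _ ?a ?b => change (@eq C a b) end.
Ltac Cring := Ceq; ring.
Ltac Cfield := Ceq; field.

(* [B] is the derivative of [F] at [z0], and [E z0] is half the second derivative. *)
Definition jet2 (F : C -> C) (z0 B : C) : Prop :=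
  exists E : C -> C, continuous E z0 /\
    locally z0 (fun z => F z = F z0 + B * (z - z0) + E z * ((z - z0) * (z - z0))).

Lemma continuous_Csub_id (z0 : C) : continuous (fun z : C => z - z0) z0.
Proof. apply continuous_Cplus; [apply continuous_id | apply continuous_const]. Qed.

Ltac prove_continuous :=
  repeat match goal with
  | |- continuous (fun _ => ?c) _ => apply continuous_const
  | |- continuous (fun z => z - ?c) _ => apply continuous_Csub_id
  | |- continuous (fun z => @?F z + @?G z) _ => apply (continuous_Cplus F G)
  | |- continuous (fun z => @?F z * @?G z) _ => apply (continuous_Cmult F G)
  | |- _ => assumption
  end.

Lemma jet2_const (c z0 : C) : jet2 (fun _ => c) z0 0.
Proof.
  exists (fun _ => 0); split; [apply continuous_const |].
  apply filter_forall; intros z; Cring.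
Qed.

Lemma jet2_id (z0 : C) : jet2 (fun z => z) z0 1.
Proof.
  exists (fun _ => 0); split; [apply continuous_const |].
  apply filter_forall; intros z; Cring.
Qed.

Lemma jet2_plus (F G : C -> C) (z0 B D : C) :
  jet2 F z0 B -> jet2 G z0 D -> jet2 (fun z => F z + G z) z0 (B + D).
Proof.
  intros [E [HE H]] [E' [HE' H']].
  exists (fun z => E z + E' z); split; [now apply continuous_Cplus |].
  generalize (filter_and _ _ H H'); apply filter_imp.
  intros z [H1 H2]; rewrite H1, H2; Cring.
Qed.

Lemma jet2_mult (F G : C -> C) (z0 B D : C) :
  jet2 F z0 B -> jet2 G z0 D -> jet2 (fun z => F z * G z) z0 (B * G z0 + F z0 * D).
Proof.
  intros [E [HE H]] [E' [HE' H']].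
  exists (fun z => F z0 * E' z + B * D + E z * G z0 + (B * E' z + E z * D) * (z - z0)
                   + E z * E' z * ((z - z0) * (z - z0))).
  split.
  - prove_continuous.
  - generalize (filter_and _ _ H H'); apply filter_imp.
    intros z [H1 H2]; rewrite H1, H2; Cring.
Qed.

Lemma jet2_ext_loc (F G : C -> C) (z0 B : C) :
  locally z0 (fun z => F z = G z) -> jet2 F z0 B -> jet2 G z0 B.
Proof.
  intros HFG [E [HE H]]; exists E; split; [exact HE |].
  assert (H0 : F z0 = G z0) by exact (locally_singleton _ _ HFG).
  generalize (filter_and _ _ H HFG); apply filter_imp.
  intros z [H1 H2]; rewrite <- H2, <- H0; exact H1.
Qed.

Lemma jet2_continuous (F : C -> C) (z0 B : C) : jet2 F z0 B -> continuous F z0.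
Proof.
  intros [E [HE H]].
  apply (continuous_ext_loc _ (fun z => F z0 + B * (z - z0) + E z * ((z - z0) * (z - z0)))).
  - generalize H; apply filter_imp; intros z Hz; symmetry; exact Hz.
  - prove_continuous.
Qed.

Lemma locally_neq_0 (F : C -> C) (z0 : C) :
  continuous F z0 -> F z0 <> 0 -> locally z0 (fun z => F z <> 0).
Proof.
  intros HF H0.
  destruct (proj1 (continuous_Cmod F z0) HF (Cmod (F z0))) as [d [Hd H]].
  { now apply Cmod_gt_0. }
  apply locally_Cmod; exists d; split; [exact Hd |].
  intros y Hy Hy0; specialize (H y Hy); rewrite Hy0 in H.
  replace (0 - F z0) with (- F z0) in H by Cring.
  rewrite Cmod_opp in H; lra.
Qed.

Lemma jet2_inv (F : C -> C) (z0 B : C) :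
  jet2 F z0 B -> F z0 <> 0 -> jet2 (fun z => / F z) z0 (- B / (F z0 * F z0)).
Proof.
  intros HF H0; assert (Hc := jet2_continuous _ _ _ HF).
  destruct HF as [E [HE H]].
  exists (fun z => (- F z0 * E z + B * B + B * E z * (z - z0)) * / (F z0 * F z0 * F z)).
  split.
  - apply continuous_Cmult.
    + prove_continuous.
    + apply continuous_Cinv; [| now repeat apply Cmult_neq_0].
      apply continuous_Cmult; [apply continuous_const | exact Hc].
  - generalize (filter_and _ _ H (locally_neq_0 _ _ Hc H0)); apply filter_imp.
    intros z [H1 H2].
    set (d := z - z0) in *; set (A := F z0) in *.
    assert (H3 : E z * (d * d) = F z - A - B * d) by (rewrite H1; Cring).
    (* Grouping the remainder as [E z * (d * d)] lets [H3] eliminate it, so that no division by [d],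
       which may be zero, occurs. *)
    transitivity (/ A + - B / (A * A) * d
      + (- A * (E z * (d * d)) + B * B * (d * d) + B * (E z * (d * d)) * d) / (A * A * F z));
      [rewrite H3 |]; Cfield; now split.
Qed.

(** Continuity of the branch is bootstrapped to second order. Factoring [G^2 - G(z0)^2] gives
    [G - G z0 = P (z - z0)] with [P] continuous; inserting this into [P - B / (2 G z0)] releases
    another factor [z - z0]. *)
Lemma jet2_sqrt (G H : C -> C) (z0 B : C) :
  continuous G z0 -> locally z0 (fun z => G z * G z = H z) -> G z0 <> 0 ->
  jet2 H z0 B -> jet2 G z0 (B / (2 * G z0)).
Proof.
  intros HG Hsq H0 [E [HE HH]].
  assert (Hsum : continuous (fun z => G z + G z0) z0).
  { apply continuous_Cplus; [exact HG | apply continuous_const]. }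
  assert (HRtoC2 : RtoC 2 <> 0) by (intros H2; injection H2; lra).
  assert (H2 : G z0 + G z0 <> 0).
  { replace (G z0 + G z0) with (2 * G z0) by ring; now apply Cmult_neq_0. }
  set (P := fun z => (B + E z * (z - z0)) * / (G z + G z0)).
  exists (fun z => (2 * G z0 * E z + - B * P z) * / (2 * G z0 * (G z + G z0))).
  assert (HP : continuous P z0).
  { apply continuous_Cmult; [| now apply continuous_Cinv].
    prove_continuous. }
  split.
  - apply continuous_Cmult.
    + prove_continuous.
    + apply continuous_Cinv; [| now repeat apply Cmult_neq_0].
      apply continuous_Cmult; [apply continuous_const | exact Hsum].
  - assert (Hsq0 : G z0 * G z0 = H z0) by exact (locally_singleton _ _ Hsq).
    generalize (filter_and _ _ (filter_and _ _ Hsq HH) (locally_neq_0 _ _ Hsum H2)).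
    apply filter_imp; intros z [[H3 H4] H5]; unfold P.
    set (d := z - z0) in *; set (g0 := G z0) in *; set (g := G z) in *.
    assert (H6 : E z * (d * d) = g * g - g0 * g0 - B * d).
    { rewrite H3, H4, <- Hsq0; Cring. }
    transitivity (g0 + B / (2 * g0) * d
      + (2 * g0 * (E z * (d * d)) * (g + g0) - B * (B * (d * d) + E z * (d * d) * d))
        / (2 * g0 * (g + g0) * (g + g0))).
    + rewrite H6; Cfield; repeat split; assumption.
    + Cfield; repeat split; assumption.
Qed.

(** * Maximum principle *)

Lemma Cmod_lt_square (z : C) (d : R) :
  (Rabs (Re z) < d)%R -> (Rabs (Im z) < d)%R -> (Cmod z < 2 * d)%R.
Proof.
  intros H1 H2; apply (Rle_lt_trans _ _ _ (Cmod_2Rmax z)).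
  assert (Hm : (Rmax (Rabs (fst z)) (Rabs (snd z)) < d)%R) by now apply Rmax_lub_lt.
  assert (Hs : (sqrt 2 < 2)%R).
  { rewrite <- (sqrt_square 2) at 2 by lra; apply sqrt_lt_1; lra. }
  assert (H0 := Rle_trans _ _ _ (Rabs_pos (fst z)) (Rmax_l _ (Rabs (snd z)))).
  assert (Hs0 := sqrt_pos 2); nra.
Qed.

(* Bounding by [1 / del] on the [del]-ball makes the Lebesgue number of the cover a bound for all of them at once. *)
Lemma bounded_of_locally_bounded (K : C -> Prop) (Psi : C -> R) (r : R) :
  (forall z, K z -> (Cmod z <= r)%R) ->
  (forall z, exists del, (0 < del)%R /\
     forall y, K y -> (Cmod (y - z) < del)%R -> (Psi y <= / del)%R) ->
  exists B, forall y, K y -> (Psi y <= B)%R.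
Proof.
  intros Hr Hloc.
  assert (Hsel : forall u v : R, {d : posreal | forall y, K y ->
    (Rabs (Re y - u) < d)%R -> (Rabs (Im y - v) < d)%R -> (Psi y <= / d)%R}).
  { intros u v; apply constructive_indefinite_description.
    destruct (Hloc (u, v)) as [d [Hd H]].
    assert (Hd2 : (0 < d / 2)%R) by lra.
    exists (mkposreal _ Hd2); intros y Hy H1 H2; simpl in *.
    apply Rle_trans with (/ d)%R.
    - apply H; [exact Hy |].
      replace d with (2 * (d / 2))%R by field.
      now apply Cmod_lt_square.
    - apply Rinv_le_contravar; lra. }
  destruct (compactness_value_2d (- r) r (- r) r (fun u v => proj1_sig (Hsel u v)))
    as [d Hd].
  exists (/ d)%R; intros y Hy.
  destruct (Rle_lt_dec (Psi y) (/ d)) as [Hle | Hlt]; [exact Hle | exfalso].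
  assert (Hy1 := Rle_trans _ _ _ (Rmax_Cmod y) (Hr y Hy)).
  assert (H1 := Rle_trans _ _ _ (Rmax_l _ _) Hy1).
  assert (H2 := Rle_trans _ _ _ (Rmax_r _ _) Hy1).
  apply Rabs_le_between in H1; apply Rabs_le_between in H2.
  apply (Hd (Re y) (Im y) H1 H2).
  intros [u [v [_ [_ [Hu [Hv Hduv]]]]]].
  assert (H3 := proj2_sig (Hsel u v) y Hy Hu Hv); simpl in H3.
  assert (H4 := Rinv_le_contravar _ _ (cond_pos d) Hduv); simpl in H4.
  lra.
Qed.

(** If the supremum [M] of an upper semicontinuous [Phi] were not attained, [1 / (M - Phi)] would be
    locally bounded on [K], hence bounded by some [B'], and [M - 1 / B'] would be a smaller upper
    bound. *)
Lemma closed_bounded_attains_max (K : C -> Prop) (Phi : C -> R) (r : R) :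
  (forall z, K z -> (Cmod z <= r)%R) ->
  (forall z, ~ K z -> locally z (fun y => ~ K y)) ->
  (forall z, K z -> forall eps, (0 < eps)%R ->
     locally z (fun y => (Phi y < Phi z + eps)%R)) ->
  (exists z, K z) ->
  exists z, K z /\ forall y, K y -> (Phi y <= Phi z)%R.
Proof.
  intros Hr Hclosed Husc [k0 Hk0].
  assert (Hbound : forall Psi : C -> R,
    (forall z, K z -> exists c, locally z (fun y => K y -> (Psi y <= c)%R)) ->
    exists B, forall y, K y -> (Psi y <= B)%R).
  { intros Psi Hloc; apply (bounded_of_locally_bounded K Psi r Hr); intros z.
    destruct (excluded_middle_informative (K z)) as [Hz | Hz].
    - destruct (Hloc z Hz) as [c Hc].
      apply locally_Cmod in Hc; destruct Hc as [d [Hd H]].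
      assert (Hc1 : (0 < Rabs c + 1)%R) by (assert (T := Rabs_pos c); lra).
      (* One number has to serve both as the radius and as the inverse of the bound. *)
      exists (Rmin d (/ (Rabs c + 1))); split.
      + apply Rmin_pos; [exact Hd | now apply Rinv_0_lt_compat].
      + intros y Hy Hyz.
        apply Rle_trans with (Rabs c + 1)%R.
        * assert (T := H y (Rlt_le_trans _ _ _ Hyz (Rmin_l _ _)) Hy).
          assert (T' := Rle_abs c); lra.
        * rewrite <- (Rinv_inv (Rabs c + 1)) at 1.
          apply Rinv_le_contravar; [| apply Rmin_r].
          apply Rmin_pos; [exact Hd | now apply Rinv_0_lt_compat].
    - assert (Hc := Hclosed z Hz).
      apply locally_Cmod in Hc; destruct Hc as [d [Hd H]].
      exists d; split; [exact Hd |]; intros y Hy Hyz; now elim (H y Hyz). }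
  destruct (Hbound Phi) as [B HB].
  { intros z Hz; exists (Phi z + 1)%R.
    generalize (Husc z Hz 1%R Rlt_0_1); apply filter_imp; intros y Hy _; now left. }
  destruct (completeness (fun v => exists y, K y /\ v = Phi y)) as [M [HM1 HM2]].
  { exists B; intros v [y [Hy ->]]; now apply HB. }
  { exists (Phi k0), k0; now split. }
  assert (HMle : forall y, K y -> (Phi y <= M)%R) by (intros y Hy; apply HM1; now exists y).
  destruct (excluded_middle_informative (exists z, K z /\ Phi z = M)) as [[z [Hz Hzm]] | Hno].
  { exists z; split; [exact Hz |]; now rewrite Hzm. }
  exfalso.
  assert (HMlt : forall y, K y -> (Phi y < M)%R).
  { intros y Hy; destruct (HMle y Hy) as [Hlt | Heq]; [exact Hlt |].
    elim Hno; now exists y. }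
  destruct (Hbound (fun y => / (M - Phi y))%R) as [B' HB'].
  { intros z Hz; assert (Hlt := HMlt z Hz).
    exists (/ ((M - Phi z) / 2))%R.
    assert (He : (0 < (M - Phi z) / 2)%R) by lra.
    generalize (Husc z Hz _ He); apply filter_imp; intros y Hy _.
    apply Rinv_le_contravar; lra. }
  assert (HB0 : (0 < B')%R).
  { apply Rlt_le_trans with (2 := HB' k0 Hk0), Rinv_0_lt_compat.
    specialize (HMlt k0 Hk0); lra. }
  assert (Hub : (M <= M - / B')%R).
  { apply HM2; intros v [y [Hy ->]].
    assert (T := HB' y Hy); assert (T' := HMlt y Hy).
    apply Rinv_le_contravar in T; [| apply Rinv_0_lt_compat; lra].
    rewrite Rinv_inv in T; lra. }
  assert (T := Rinv_0_lt_compat _ HB0); lra.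
Qed.

Lemma Cmod_sqr (z : C) : (Cmod z * Cmod z = Re z * Re z + Im z * Im z)%R.
Proof. assert (T := Cmod2_alt z); simpl in T; lra. Qed.

Lemma Cmod_sqr_plus_ge (X Y : C) :
  (Cmod X * Cmod X - 2 * Cmod X * Cmod Y <= Cmod (X + Y) * Cmod (X + Y))%R.
Proof.
  assert (T := Cmod_triangle (X + Y) (- Y)).
  replace (X + Y + - Y) with X in T by ring; rewrite Cmod_opp in T.
  assert (HX := Cmod_ge_0 X); assert (HY := Cmod_ge_0 Y); assert (HXY := Cmod_ge_0 (X + Y)).
  destruct (Rle_lt_dec (Cmod Y) (Cmod X)); nra.
Qed.

(* Averaging over the four points [z0 + t u], [u^4 = 1], kills the terms
   [Re (conj A B u)] and [Re (conj A E u^2)] of the expansion of [|F|^2]. *)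
Lemma jet2_no_local_max (F : C -> C) (z0 B : C) (eps : R) :
  jet2 F z0 B -> (0 < eps)%R ->
  ~ locally z0 (fun z => (Cmod (F z) * Cmod (F z) + eps * (Cmod z * Cmod z)
                    <= Cmod (F z0) * Cmod (F z0) + eps * (Cmod z0 * Cmod z0))%R).
Proof.
  intros [E [HE HF]] Heps Hmax.
  set (A := F z0) in *; set (E0 := E z0).
  set (m := (Cmod A + Cmod B + Cmod E0)%R).
  assert (HA := Cmod_ge_0 A); assert (HB := Cmod_ge_0 B); assert (HE0 := Cmod_ge_0 E0).
  assert (Hm : (0 <= m)%R) by (unfold m; lra).
  (* Replacing [E] by [E0] costs at most [2 m eta t^2] in [|F|^2]; this [eta] keeps the cost below
     the gain [eps t^2] of the perturbation. *)
  set (eta := (eps / (2 * (m + 1)))%R).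
  assert (Heta : (0 < eta)%R) by (apply Rdiv_lt_0_compat; lra).
  assert (Hmeta : (2 * (m * eta) < eps)%R).
  { replace eps with (2 * (m * eta) + 2 * eta)%R by (unfold eta; field; lra). lra. }
  assert (HEl : locally z0 (fun z => (Cmod (E z - E0) < eta)%R)).
  { apply locally_Cmod, (proj1 (continuous_Cmod E z0) HE eta Heta). }
  assert (Hall := filter_and _ _ (filter_and _ _ HF HEl) Hmax).
  apply locally_Cmod in Hall; destruct Hall as [d [Hd Hall]].
  set (t := Rmin (d / 2) 1).
  assert (Ht : (0 < t)%R) by (apply Rmin_pos; lra).
  assert (Htd : (t < d)%R) by (unfold t; assert (T := Rmin_l (d / 2) 1); lra).
  assert (Ht1 : (t <= 1)%R) by apply Rmin_r.
  (* [X] is the quadratic Taylor polynomial of [F] at [z0 + t u]; [t <= 1] gives [Cmod X <= m]. *)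
  assert (Hu : forall u : C, Cmod u = 1%R ->
    let X := A + B * (t * u) + E0 * (t * u * (t * u)) in
    (Cmod X * Cmod X - 2 * (m * eta) * (t * t) + eps * (Cmod (z0 + t * u) * Cmod (z0 + t * u))
     <= Cmod A * Cmod A + eps * (Cmod z0 * Cmod z0))%R).
  { intros u Hu X.
    assert (Hzu : z0 + t * u - z0 = t * u) by ring.
    assert (Htu : Cmod (t * u) = t).
    { rewrite Cmod_mult, Hu, Cmod_R, Rabs_pos_eq by lra; ring. }
    destruct (Hall (z0 + t * u)) as [[H1 H2] H3].
    { rewrite Hzu, Htu; exact Htd. }
    rewrite Hzu in H1.
    assert (HX : F (z0 + t * u) = X + (E (z0 + t * u) - E0) * (t * u * (t * u))).
    { rewrite H1; unfold X; ring. }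
    assert (HXm : (Cmod X <= m)%R).
    { unfold X, m.
      eapply Rle_trans; [apply Cmod_triangle |].
      apply Rplus_le_compat.
      - eapply Rle_trans; [apply Cmod_triangle |].
        apply Rplus_le_compat_l; rewrite Cmod_mult, Htu; nra.
      - rewrite !Cmod_mult, Cmod_R, Rabs_pos_eq, Hu by lra.
        assert (t * t <= 1)%R by nra. nra. }
    set (Y := (E (z0 + t * u) - E0) * (t * u * (t * u))) in *.
    assert (HY : (Cmod Y <= eta * (t * t))%R).
    { unfold Y; rewrite Cmod_mult, (Cmod_mult (t * u) (t * u)), Htu.
      apply Rmult_le_compat_r; [nra | now left]. }
    assert (Hge := Cmod_sqr_plus_ge X Y).
    rewrite <- HX in Hge.
    assert (HX0 := Cmod_ge_0 X).
    assert (HYm : (Cmod X * Cmod Y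
                  <= m * (eta * (t * t)))%R).
    { apply Rmult_le_compat; [exact HX0 | apply Cmod_ge_0 | exact HXm | exact HY]. }
    lra. }
  assert (HCi : Cmod Ci = 1%R).
  { unfold Cmod, Ci; simpl; replace (0 * (0 * 1) + 1 * (1 * 1))%R with 1%R by ring; apply sqrt_1. }
  assert (U1 := Hu 1 Cmod_1); assert (U2 := Hu Ci HCi).
  assert (U3 := Hu (- (1)) Cmod_m1).
  assert (U4 := Hu (- Ci)); rewrite Cmod_opp in U4; specialize (U4 HCi).
  cbv zeta in U1, U2, U3, U4; rewrite !Cmod_sqr in U1, U2, U3, U4.
  destruct A as [a1 a2], B as [b1 b2], E0 as [e1 e2], z0 as [x y].
  simpl in U1, U2, U3, U4.
  assert (Htt : (0 < t * t)%R) by nra.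
  (* The average of [|X|^2] is [|A|^2 + |B|^2 t^2 + |E0|^2 t^4] and that of [|z0 + t u|^2] is
     [|z0|^2 + t^2], so summing [U1] to [U4] contradicts [Hs] and [Hp]. *)
  assert (Hs : (0 <= (b1 * b1 + b2 * b2) * (t * t) + (e1 * e1 + e2 * e2) * (t * t * (t * t)))%R) by nra.
  assert (Hp : (0 < (eps - 2 * (m * eta)) * (t * t))%R) by (apply Rmult_lt_0_compat; lra).
  clearbody m eta t; clear - U1 U2 U3 U4 Hs Hp.
  nra.
Qed.

Lemma Cmod_sqr_perturbed_usc (F : C -> C) (eps : R) (z0 : C) :
  continuous F z0 ->
  forall eta, (0 < eta)%R -> locally z0 (fun z =>
    (Cmod (F z) * Cmod (F z) + eps * (Cmod z * Cmod z)
     < Cmod (F z0) * Cmod (F z0) + eps * (Cmod z0 * Cmod z0) + eta)%R).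
Proof.
  intros HF eta Heta.
  assert (HG : continuous (fun z => Cmod (F z) * Cmod (F z) + eps * (Cmod z * Cmod z))%R z0).
  { assert (HN : forall G : C -> C, continuous G z0 ->
      continuous (fun z => Cmod (G z) * Cmod (G z))%R z0).
    { intros G HG; apply (continuous_mult (K := R_AbsRing));
        apply (continuous_comp G Cmod _ HG (filterlim_norm (V := C_NormedModule) (G z0))). }
    apply (continuous_plus (V := R_NormedModule)).
    - exact (HN F HF).
    - apply (continuous_scal_r (V := R_NormedModule)).
      exact (HN (fun z => z) (continuous_id _)). }
  assert (H := proj1 (filterlim_locally _ _) HG (mkposreal eta Heta)).
  generalize H; apply filter_imp; intros z Hz.
  apply Rabs_lt_between' in Hz; simpl in Hz; lra.
Qed.

(** A maximum above [M >= 0] can only lie where [F] is nonzero, so jets are asked only there. This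
    admits functions that vanish at [0] and are merely continuous at that point. *)
Lemma max_principle (F : C -> C) (r M : R) :
  (0 <= M)%R ->
  (forall z, (Cmod z <= r)%R -> continuous F z) ->
  (forall z, (Cmod z < r)%R -> F z <> 0 -> exists B, jet2 F z B) ->
  (forall z, Cmod z = r -> (Cmod (F z) <= M)%R) ->
  forall z, (Cmod z <= r)%R -> (Cmod (F z) <= M)%R.
Proof.
  intros HM Hcont Hjet Hbd y Hy.
  destruct (Rle_lt_dec (Cmod (F y)) M) as [Hle | Hlt]; [exact Hle | exfalso].
  assert (Hr : (0 <= r)%R) by (assert (T := Cmod_ge_0 y); lra).
  set (gap := (Cmod (F y) * Cmod (F y) - M * M)%R).
  assert (Hgap : (0 < gap)%R) by (unfold gap; nra).
  assert (Hr2 : (0 < r * r + 1)%R) by nra.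
  (* On the disk the perturbation stays below [gap], so a maximum point of the perturbed function
     still satisfies [Cmod (F z1) > M]. *)
  set (eps := (gap / (r * r + 1))%R).
  assert (Heps : (0 < eps)%R) by now apply Rdiv_lt_0_compat.
  assert (Hepsr : (eps * (r * r) < gap)%R).
  { replace gap with (eps * (r * r + 1))%R by (unfold eps; field; lra). lra. }
  destruct (closed_bounded_attains_max (fun z => Cmod z <= r)%R
    (fun z => Cmod (F z) * Cmod (F z) + eps * (Cmod z * Cmod z))%R r) as [z1 [Hz1 Hmax]].
  - auto.
  - intros z Hz; apply Rnot_le_lt in Hz.
    apply locally_Cmod; exists (Cmod z - r)%R; split; [lra |].
    intros x Hx Hxr.
    assert (T := Cmod_triangle x (- (x - z))).
    replace (x + - (x - z)) with z in T by ring; rewrite Cmod_opp in T; lra.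
  - intros z Hz eta; apply Cmod_sqr_perturbed_usc; auto.
  - now exists y.
  - assert (Hy1 := Hmax y Hy).
    assert (Hyy : (0 <= Cmod y * Cmod y)%R) by (assert (T := Cmod_ge_0 y); nra).
    assert (T1 := Cmod_ge_0 z1); assert (T2 := Cmod_ge_0 (F z1)).
    assert (Hzr : (Cmod z1 * Cmod z1 <= r * r)%R) by nra.
    assert (Hbig : (M * M < Cmod (F z1) * Cmod (F z1))%R) by (unfold gap in *; nra).
    destruct Hz1 as [Hz1 | Hz1].
    + destruct (Hjet z1 Hz1) as [B HB].
      { intros H0; rewrite H0, Cmod_0 in Hbig; nra. }
      apply (jet2_no_local_max F z1 B eps HB Heps).
      apply locally_Cmod; exists (r - Cmod z1)%R; split; [lra |].
      intros x Hx; apply Hmax.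
      assert (T := Cmod_triangle z1 (x - z1)).
      replace (z1 + (x - z1)) with x in T by ring; lra.
    + assert (T := Hbd z1 Hz1); nra.
Qed.

(** * Schwarz and Schwarz-Pick *)

Lemma jet2_pow (F : C -> C) (z0 : C) (n : nat) :
  (exists B, jet2 F z0 B) -> exists B, jet2 (fun z => F z ^ n) z0 B.
Proof.
  intros [B HB]; induction n as [| n [B' IH]].
  - exists 0; exact (jet2_const 1 z0).
  - eexists; exact (jet2_mult _ _ _ _ _ HB IH).
Qed.

Lemma Cmod_pow (z : C) (n : nat) : Cmod (z ^ n) = (Cmod z ^ n)%R.
Proof.
  induction n as [| n IH]; simpl; [apply Cmod_1 |].
  now rewrite Cmod_mult, IH.
Qed.

Lemma pow_bounded_le_1 (q M : R) : (forall n, (q ^ n <= M)%R) -> (q <= 1)%R.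
Proof.
  intros H; destruct (Rle_lt_dec q 1) as [Hle | Hlt]; [exact Hle | exfalso].
  destruct (Pow_x_infinity q) with (b := (M + 1)%R) as [N HN].
  { rewrite Rabs_pos_eq; lra. }
  specialize (HN N (le_n N)); rewrite Rabs_pos_eq in HN by (apply pow_le; lra).
  specialize (H N); lra.
Qed.

(* The maximum principle is applied to [z (W z / z)^n]: the extra factor [z] makes it
   vanish at [0], so nothing is needed there about [W z / z] beyond boundedness. *)
Lemma schwarz (W : C -> C) (r K : R) :
  (forall z : C, z <> 0 -> (Cmod z < r)%R -> exists B, jet2 W z B) ->
  (forall z : C, z <> 0 -> (Cmod z < r)%R -> (Cmod (W z) <= 1)%R) ->
  locally (RtoC 0) (fun z : C => z <> 0 -> (Cmod (W z) <= K * Cmod z)%R) ->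
  forall z : C, z <> 0 -> (Cmod z < r)%R -> (Cmod (W z) <= Cmod z / r)%R.
Proof.
  intros Hjet Hle1 H0 z Hz Hzr.
  assert (Hzp := proj1 (Cmod_gt_0 z) Hz).
  (* [W] is controlled only on the open disk, so the maximum principle is used on the smaller closed
     disks of radius [rho]. *)
  assert (Hkey : forall rho, (Cmod z < rho)%R -> (rho < r)%R -> (Cmod (W z) * rho <= Cmod z)%R).
  { intros rho Hzrho Hrho.
    assert (Hrp : (0 < rho)%R) by lra.
    assert (Hn : forall n, ((Cmod (W z) / Cmod z) ^ n * Cmod z <= rho * / rho ^ n)%R).
    { intros n.
      replace ((Cmod (W z) / Cmod z) ^ n * Cmod z)%R
        with (Cmod (z * (W z * / z) ^ n)).
      2:{ rewrite Cmod_mult, Cmod_pow, Cmod_mult, Cmod_inv by exact Hz.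
          unfold Rdiv; ring. }
      apply (max_principle (fun x => x * (W x * / x) ^ n) rho); [| | | | lra].
      - apply Rmult_le_pos; [lra |]; left; apply Rinv_0_lt_compat, pow_lt; lra.
      - intros x Hx; destruct (Ceq_dec x 0) as [-> | Hx0].
        + apply locally_Cmod in H0; destruct H0 as [d [Hd H0]].
          apply continuous_Cmod; intros eps Heps.
          assert (HK : (0 < Rabs K ^ n + 1)%R).
          { assert (T := pow_le _ n (Rabs_pos K)); lra. }
          exists (Rmin d (eps / (Rabs K ^ n + 1))); split.
          { apply Rmin_pos; [exact Hd | now apply Rdiv_lt_0_compat]. }
          intros y Hy.
          assert (Hy1 := Rlt_le_trans _ _ _ Hy (Rmin_l _ _)).
          assert (Hy2 := Rlt_le_trans _ _ _ Hy (Rmin_r _ _)).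
          (* Whatever value [/ 0] takes, the leading factor makes the function vanish at [0]. *)
          replace (y * (W y * / y) ^ n - 0 * (W 0 * / 0) ^ n)
            with (y * (W y * / y) ^ n) by ring.
          replace (y - 0) with y in Hy2 by ring.
          destruct (Ceq_dec y 0) as [-> | Hy0].
          { rewrite Cmult_0_l, Cmod_0; exact Heps. }
          assert (Hyp := proj1 (Cmod_gt_0 y) Hy0).
          rewrite Cmod_mult, Cmod_pow, Cmod_mult, Cmod_inv by exact Hy0.
          assert (HWy : (Cmod (W y) * / Cmod y <= Rabs K)%R).
          { apply (Rmult_le_reg_r (Cmod y)); [exact Hyp |].
            rewrite Rmult_assoc, Rinv_l, Rmult_1_r by lra.
            apply Rle_trans with (1 := H0 y Hy1 Hy0).
            apply Rmult_le_compat_r; [lra | apply Rle_abs]. }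
          assert (Hpow : ((Cmod (W y) * / Cmod y) ^ n <= Rabs K ^ n)%R).
          { apply pow_incr; split; [| exact HWy].
            apply Rmult_le_pos; [apply Cmod_ge_0 | left; now apply Rinv_0_lt_compat]. }
          apply Rle_lt_trans with (Cmod y * (Rabs K ^ n + 1))%R.
          { apply Rmult_le_compat_l; lra. }
          replace eps with (eps / (Rabs K ^ n + 1) * (Rabs K ^ n + 1))%R by (field; lra).
          now apply Rmult_lt_compat_r.
        + destruct (Hjet x Hx0) as [B HB]; [lra |].
          destruct (jet2_pow (fun x => W x * / x) x n) as [B' HB'].
          { eexists; apply jet2_mult; [exact HB | apply jet2_inv; [apply jet2_id | exact Hx0]]. }
          exact (jet2_continuous _ _ _ (jet2_mult _ _ _ _ _ (jet2_id x) HB')).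
      - intros x Hx Hx1.
        assert (Hx0 : x <> 0) by (intros ->; apply Hx1; ring).
        destruct (Hjet x Hx0) as [B HB]; [lra |].
        destruct (jet2_pow (fun x => W x * / x) x n) as [B' HB'].
        { eexists; apply jet2_mult; [exact HB | apply jet2_inv; [apply jet2_id | exact Hx0]]. }
        eexists; exact (jet2_mult _ _ _ _ _ (jet2_id x) HB').
      - intros x Hx.
        assert (Hx0 : x <> 0) by (apply Cmod_gt_0; lra).
        rewrite Cmod_mult, Cmod_pow, Cmod_mult, Cmod_inv, Hx by exact Hx0.
        apply Rmult_le_compat_l; [lra |].
        rewrite <- pow_inv.
        assert (Hir := Rinv_0_lt_compat _ Hrp).
        apply pow_incr; split.
        + apply Rmult_le_pos; [apply Cmod_ge_0 | lra].
        + assert (T : (Cmod (W x) <= 1)%R) by (apply Hle1; [exact Hx0 | lra]). nra. }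
    (* The extra factor costs only a constant: the powers of this number stay below [rho / |z|] for
       all [n], which forces it to be at most [1]. *)
    assert (Hq : (Cmod (W z) / Cmod z * rho <= 1)%R).
    { apply (pow_bounded_le_1 _ (rho / Cmod z)); intros n.
      apply (Rmult_le_reg_r (Cmod z * / rho ^ n)).
      { apply Rmult_lt_0_compat; [exact Hzp | apply Rinv_0_lt_compat, pow_lt, Hrp]. }
      rewrite Rpow_mult_distr.
      assert (Hpn := pow_lt _ n Hrp).
      replace ((Cmod (W z) / Cmod z) ^ n * rho ^ n * (Cmod z * / rho ^ n))%R
        with ((Cmod (W z) / Cmod z) ^ n * Cmod z)%R by (field; lra).
      replace (rho / Cmod z * (Cmod z * / rho ^ n))%R with (rho * / rho ^ n)%R by (field; lra).
      apply Hn. }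
    replace (Cmod (W z) * rho)%R with (Cmod (W z) / Cmod z * rho * Cmod z)%R by (field; lra).
    nra. }
  destruct (Rle_lt_dec (Cmod (W z) * r) (Cmod z)) as [Hle | Hlt].
  - apply (Rmult_le_reg_r r); [lra |].
    unfold Rdiv; rewrite Rmult_assoc, Rinv_l, Rmult_1_r by lra; exact Hle.
  - exfalso.
    (* In place of the limit [rho -> r]: if the claim fails then [q = |z| / |W z| < r], and [Hkey]
       at the midpoint of [q] and [r] is contradictory. *)
    assert (HW0 := Cmod_ge_0 (W z)); assert (HW1 := Hle1 z Hz Hzr).
    assert (HWp : (0 < Cmod (W z))%R) by nra.
    set (q := (Cmod z / Cmod (W z))%R).
    assert (Hq : (q * Cmod (W z) = Cmod z)%R) by (unfold q; field; lra).
    assert (Hq1 : (Cmod z <= q)%R).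
    { assert (0 < q)%R by (apply Rdiv_lt_0_compat; lra). nra. }
    assert (Hqr : (q < r)%R) by nra.
    assert (T : (Cmod (W z) * ((q + r) / 2) <= Cmod z)%R) by (apply Hkey; lra).
    nra.
Qed.

(** This is why the disk automorphism [(V - b) / (1 - conj b V)] has modulus at most [1] when [|b|]
    and [|V|] do. *)
Lemma blaschke_identity (b V : C) :
  (Cmod (1 - Cconj b * V) * Cmod (1 - Cconj b * V) - Cmod (V - b) * Cmod (V - b)
   = (1 - Cmod V * Cmod V) * (1 - Cmod b * Cmod b))%R.
Proof. rewrite !Cmod_sqr; destruct b, V; simpl; ring. Qed.

Lemma Cmod_Cconj (z : C) : Cmod (Cconj z) = Cmod z.
Proof. destruct z as [x y]; unfold Cmod, Cconj; simpl; f_equal; ring. Qed.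

(* For [c = 1] the conclusion is that of [schwarz], so no bound on [B] is required. *)
Lemma schwarz_pick (W : C -> C) (r c : R) (B : C) :
  W 0 = 0 -> jet2 W 0 B ->
  (forall z : C, z <> 0 -> (Cmod z < r)%R -> exists B, jet2 W z B) ->
  (forall z : C, z <> 0 -> (Cmod z < r)%R -> (Cmod (W z) <= 1)%R) ->
  (r * Cmod B <= c)%R \/ c = 1%R -> (c <= 1)%R ->
  forall z : C, z <> 0 -> (Cmod z < r)%R ->
  (Cmod (W z) * (1 + c * (Cmod z / r)) <= Cmod z / r * (Cmod z / r + c))%R.
Proof.
  intros HW0 HWB Hjet Hle1 Hc Hc1 z Hz Hzr.
  assert (Hzp := proj1 (Cmod_gt_0 z) Hz).
  assert (Hr : (0 < r)%R) by lra.
  destruct HWB as [E [HE HW]].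
  assert (HEl : locally (RtoC 0) (fun z : C => (Cmod (E z - E 0) < 1)%R)).
  { apply locally_Cmod, (proj1 (continuous_Cmod E 0) HE 1%R Rlt_0_1). }
  assert (HEb : locally (RtoC 0) (fun z : C => (Cmod (E z) <= Cmod (E 0) + 1)%R)).
  { generalize HEl; apply filter_imp; intros y Hy.
    assert (T := Cmod_triangle (E y - E 0) (E 0)).
    replace (E y - E 0 + E 0) with (E y) in T by ring. lra. }
  assert (HW' : locally (RtoC 0) (fun z : C => W z = B * z + E z * (z * z))).
  { generalize HW; apply filter_imp; intros y Hy; rewrite Hy, HW0; Cring. }
  assert (Hs : forall z : C, z <> 0 -> (Cmod z < r)%R -> (Cmod (W z) <= Cmod z / r)%R).
  { apply (schwarz W r (Cmod B + (Cmod (E 0) + 1))); [exact Hjet | exact Hle1 |].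
    assert (H1 : locally (RtoC 0) (fun z : C => (Cmod (z - 0) < 1)%R)).
    { apply locally_Cmod; exists 1%R; split; [lra | auto]. }
    generalize (filter_and _ _ (filter_and _ _ HW' HEb) H1); apply filter_imp.
    intros y [[H2 H3] H4] _; rewrite H2.
    replace (y - 0) with y in H4 by Cring.
    eapply Rle_trans; [apply Cmod_triangle |].
    rewrite !Cmod_mult.
    assert (T := Cmod_ge_0 y); assert (T' := Cmod_ge_0 (E y)).
    assert (T1 : (Cmod (E y) * Cmod y <= Cmod (E 0) + 1)%R) by nra.
    assert (T2 := Rmult_le_compat_r _ _ _ T T1); lra. }
  set (t := (Cmod z / r)%R).
  assert (Ht0 : (0 < t)%R) by now apply Rdiv_lt_0_compat.
  assert (Ht1 : (t < 1)%R).
  { apply (Rmult_lt_reg_r r); [exact Hr |]. unfold t, Rdiv.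
    rewrite Rmult_assoc, Rinv_l, Rmult_1_r, Rmult_1_l by lra; exact Hzr. }
  assert (HWt := Hs z Hz Hzr); fold t in HWt.
  assert (HWp := Cmod_ge_0 (W z)).
  destruct (Req_dec c 1) as [-> | Hcn]; [nra |].
  destruct Hc as [Hc | Hc]; [| contradiction].
  (* [b] is the limit at [0] of [V z = r W z / z]. The Schwarz lemma is applied to the Blaschke
     transform of [V], which tends to [0] there; the literal value of [V] at [0] never enters. *)
  set (b := r * B).
  assert (Hb : (Cmod b <= c)%R) by (unfold b; rewrite Cmod_mult, Cmod_R, Rabs_pos_eq by lra; exact Hc).
  assert (Hb0 := Cmod_ge_0 b).
  set (V := fun z => r * (W z * / z)).
  assert (HVmod : forall z : C, z <> 0 -> (Cmod (V z) = Cmod (W z) / (Cmod z / r))%R).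
  { intros y Hy; unfold V.
    rewrite !Cmod_mult, Cmod_inv, Cmod_R, Rabs_pos_eq by (exact Hy || lra).
    assert (T := proj1 (Cmod_gt_0 y) Hy); field; lra. }
  assert (HV1 : forall z : C, z <> 0 -> (Cmod z < r)%R -> (Cmod (V z) <= 1)%R).
  { intros y Hy Hyr; rewrite HVmod by exact Hy.
    assert (T := proj1 (Cmod_gt_0 y) Hy).
    assert (T' : (0 < Cmod y / r)%R) by now apply Rdiv_lt_0_compat.
    apply (Rmult_le_reg_r (Cmod y / r)); [exact T' |].
    unfold Rdiv at 1; rewrite Rmult_assoc, Rinv_l, Rmult_1_r, Rmult_1_l by lra.
    now apply Hs. }
  (* Here [c < 1], which keeps the Blaschke denominator away from zero. *)
  assert (Hden : forall z : C, z <> 0 -> (Cmod z < r)%R -> (1 - c <= Cmod (1 - Cconj b * V z))%R).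
  { intros y Hy Hyr.
    assert (T := Cmod_triangle (1 - Cconj b * V y) (Cconj b * V y)).
    replace (1 - Cconj b * V y + Cconj b * V y) with (RtoC 1) in T by ring.
    rewrite Cmod_1, Cmod_mult, Cmod_Cconj in T.
    assert (T1 := HV1 y Hy Hyr); assert (T2 := Cmod_ge_0 (V y)); nra. }
  assert (Hden0 : forall z : C, z <> 0 -> (Cmod z < r)%R -> 1 - Cconj b * V z <> 0).
  { intros y Hy Hyr; apply Cmod_gt_0; assert (T := Hden y Hy Hyr); lra. }
  assert (Hpsi : (Cmod ((V z - b) * / (1 - Cconj b * V z)) <= t)%R).
  { apply (schwarz (fun z => (V z - b) * / (1 - Cconj b * V z)) r
             (r * (Cmod (E 0) + 1) * / (1 - c))); [| | | exact Hz | exact Hzr].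
    - intros y Hy Hyr; destruct (Hjet y Hy Hyr) as [By HBy].
      assert (HVy : exists D, jet2 V y D).
      { eexists; apply jet2_mult; [apply jet2_const |].
        apply jet2_mult; [exact HBy | apply jet2_inv; [apply jet2_id | exact Hy]]. }
      destruct HVy as [D HD].
      eexists; apply jet2_mult.
      + exact (jet2_plus V (fun _ => - b) _ _ _ HD (jet2_const _ _)).
      + apply (jet2_inv (fun z => 1 - Cconj b * V z)); [| now apply Hden0].
        apply (jet2_ext_loc (fun z => 1 + - Cconj b * V z)).
        { apply filter_forall; intros x; Cring. }
        exact (jet2_plus (fun _ => RtoC 1) _ _ _ _ (jet2_const _ _)
                 (jet2_mult (fun _ => - Cconj b) V _ _ _ (jet2_const _ _) HD)).
    - intros y Hy Hyr.
      rewrite Cmod_mult, Cmod_inv by now apply Hden0.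
      assert (T := Hden y Hy Hyr); assert (T1 := HV1 y Hy Hyr).
      assert (T2 := Cmod_ge_0 (V y)); assert (T3 := Cmod_ge_0 (V y - b)).
      assert (T4 := blaschke_identity b (V y)).
      apply (Rmult_le_reg_r (Cmod (1 - Cconj b * V y))); [lra |].
      rewrite Rmult_assoc, Rinv_l, Rmult_1_r, Rmult_1_l by lra.
      assert (0 <= (1 - Cmod (V y) * Cmod (V y)) * (1 - Cmod b * Cmod b))%R.
      { apply Rmult_le_pos; nra. }
      apply Rsqr_incr_0_var; unfold Rsqr; lra.
    - assert (H1 : locally (RtoC 0) (fun z : C => (Cmod (z - 0) < r)%R)).
      { apply locally_Cmod; exists r; split; [lra | auto]. }
      generalize (filter_and _ _ (filter_and _ _ HW' HEb) H1); apply filter_imp.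
      intros y [[H2 H3] H4] Hy.
      replace (y - 0) with y in H4 by Cring.
      rewrite Cmod_mult, Cmod_inv by now apply Hden0.
      assert (HVb : V y - b = r * (E y * y)).
      { unfold V, b; rewrite H2; Cfield; exact Hy. }
      rewrite HVb, !Cmod_mult, Cmod_R, Rabs_pos_eq by lra.
      assert (T := Hden y Hy H4).
      assert (T1 := Rinv_le_contravar (1 - c) _ ltac:(lra) T).
      assert (T2 := Cmod_ge_0 y); assert (T3 := Cmod_ge_0 (E y)).
      assert (T4 : (0 < / Cmod (1 - Cconj b * V y))%R) by (apply Rinv_0_lt_compat; lra).
      replace (r * (Cmod (E 0) + 1) * / (1 - c) * Cmod y)%R
        with (r * ((Cmod (E 0) + 1) * Cmod y) * / (1 - c))%R by ring.
      apply Rmult_le_compat; [| lra | | exact T1].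
      + apply Rmult_le_pos; [lra | now apply Rmult_le_pos].
      + apply Rmult_le_compat_l; [lra |]; now apply Rmult_le_compat_r. }
  rewrite Cmod_mult, Cmod_inv in Hpsi by now apply Hden0.
  assert (Hd := Hden z Hz Hzr).
  assert (HVb : (Cmod (V z - b) <= t * Cmod (1 - Cconj b * V z))%R).
  { replace (Cmod (V z - b)) with
      (Cmod (V z - b) * / Cmod (1 - Cconj b * V z) * Cmod (1 - Cconj b * V z))%R
      by (field; lra).
    apply Rmult_le_compat_r; lra. }
  assert (HV := HV1 z Hz Hzr); assert (HV0 := Cmod_ge_0 (V z)).
  assert (HWV : (Cmod (W z) = t * Cmod (V z))%R).
  { rewrite HVmod by exact Hz; unfold t; field; lra. }
  assert (Hre : (Re (Cconj b * V z) <= Cmod b * Cmod (V z))%R).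
  { rewrite <- (Cmod_Cconj b), <- Cmod_mult.
    apply Rle_trans with (1 := Rle_abs _), re_le_Cmod. }
  assert (Hsq : (Cmod (V z - b) * Cmod (V z - b)
    = Cmod (V z) * Cmod (V z) + Cmod b * Cmod b - 2 * Re (Cconj b * V z))%R).
  { rewrite !Cmod_sqr; destruct b, (V z); simpl; ring. }
  assert (Hid := blaschke_identity b (V z)).
  assert (Hnb := Cmod_ge_0 (V z - b)).
  (* In [|V - b|^2 - t^2 |1 - conj b V|^2] the real part of [conj b V] has coefficient
     [-2 (1 - t^2)], so replacing it by [|b| |V|] only decreases the expression. *)
  assert (Hfin : ((Cmod (V z) - Cmod b) * (Cmod (V z) - Cmod b)
    <= t * (1 - Cmod b * Cmod (V z)) * (t * (1 - Cmod b * Cmod (V z))))%R).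
  { assert (H1 : (Cmod (V z - b) * Cmod (V z - b) <= t * t *
      (Cmod (1 - Cconj b * V z) * Cmod (1 - Cconj b * V z)))%R).
    { apply Rle_trans with ((t * Cmod (1 - Cconj b * V z)) * (t * Cmod (1 - Cconj b * V z)))%R.
      - apply Rmult_le_compat; assumption.
      - right; ring. }
    assert (H2 : (0 <= (1 - t * t) * (Cmod b * Cmod (V z) - Re (Cconj b * V z)))%R).
    { apply Rmult_le_pos; nra. }
    nra. }
  assert (Hlin : (Cmod (V z) - Cmod b <= t * (1 - Cmod b * Cmod (V z)))%R).
  { apply Rsqr_incr_0_var; [exact Hfin | apply Rmult_le_pos; nra]. }
  (* The bound [(t + |b|) / (1 + |b| t)] increases with [|b|], so [c] may replace [|b|]. *)
  assert (Hmono : (Cmod (V z) * (1 + c * t) <= t + c)%R).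
  { assert (0 <= (c - Cmod b) * (1 - t * Cmod (V z)))%R by (apply Rmult_le_pos; nra).
    nra. }
  rewrite HWV; nra.
Qed.

(** * Power series and first-order behaviour *)

Lemma pow_n_Cpow (z : C) (n : nat) : @pow_n C_Ring z n = z ^ n.
Proof. induction n as [| n IH]; [reflexivity |]. simpl; rewrite IH; reflexivity. Qed.

(* [z ^ n] has derivative [dpow z n] and half second derivative [d2pow z n]. *)
Fixpoint dpow (z : C) (n : nat) : C :=
  match n with O => 0 | S k => z * dpow z k + z ^ k end.

Fixpoint d2pow (z : C) (n : nat) : C :=
  match n with O => 0 | S k => z * d2pow z k + dpow z k end.

(** A Cauchy estimate: for [|z|] in place of [z] the left side is the linear term in [del] of the
    binomial expansion on the right, whose terms are all nonnegative. [Cmod_d2pow_le] uses the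
    quadratic term. *)
Lemma Cmod_dpow_le (z : C) (del : R) (n : nat) :
  (0 < del)%R -> (Cmod (dpow z n) * del <= (Cmod z + del) ^ n)%R.
Proof.
  intros Hd; assert (Hz := Cmod_ge_0 z).
  induction n as [| n IH]; simpl; [rewrite Cmod_0; lra |].
  assert (T := Cmod_triangle (z * dpow z n) (z ^ n)).
  rewrite Cmod_mult, Cmod_pow in T.
  assert (T1 : (Cmod z ^ n <= (Cmod z + del) ^ n)%R) by (apply pow_incr; lra).
  assert (T2 := Rmult_le_compat_l _ _ _ Hz IH).
  assert (T3 : (Cmod z ^ n * del <= (Cmod z + del) ^ n * del)%R) by (apply Rmult_le_compat_r; lra).
  apply Rle_trans with ((Cmod z * Cmod (dpow z n) + Cmod z ^ n) * del)%R; [| nra].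
  apply Rmult_le_compat_r; lra.
Qed.

Lemma Cmod_d2pow_le (z : C) (del : R) (n : nat) :
  (0 < del)%R -> (Cmod (d2pow z n) * (del * del) <= (Cmod z + del) ^ n)%R.
Proof.
  intros Hd; assert (Hz := Cmod_ge_0 z).
  induction n as [| n IH]; simpl; [rewrite Cmod_0; lra |].
  assert (T := Cmod_triangle (z * d2pow z n) (dpow z n)).
  rewrite Cmod_mult in T.
  assert (T1 := Cmod_dpow_le z del n Hd).
  assert (T2 := Rmult_le_compat_l _ _ _ Hz IH).
  assert (T3 : (Cmod (dpow z n) * del * del <= (Cmod z + del) ^ n * del)%R)
    by (apply Rmult_le_compat_r; lra).
  apply Rle_trans with ((Cmod z * Cmod (d2pow z n) + Cmod (dpow z n)) * (del * del))%R; [| nra].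
  apply Rmult_le_compat_r; nra.
Qed.

(** The remainders satisfy [T (n + 1) = (z + h) T n + d2pow z n h^3]. With [|h| <= del / 2] and the
    factor [2], the two contributions add up to exactly [|z| + del] times the previous bound. *)
Lemma Cmod_pow_remainder_le (z h : C) (del : R) (n : nat) :
  (0 < del)%R -> (Cmod h <= del / 2)%R ->
  (Cmod ((z + h) ^ n - z ^ n - dpow z n * h - d2pow z n * (h * h)) * (del * del * del)
   <= 2 * (Cmod h * Cmod h * Cmod h) * (Cmod z + del) ^ n)%R.
Proof.
  intros Hd Hh; assert (Hz := Cmod_ge_0 z); assert (Hh0 := Cmod_ge_0 h).
  induction n as [| n IH].
  - simpl; replace (1 - 1 - 0 * h - 0 * (h * h)) with (RtoC 0) by ring.
    rewrite Cmod_0.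
    assert (0 <= Cmod h * Cmod h * Cmod h)%R by (repeat apply Rmult_le_pos; lra). lra.
  - set (T := (z + h) ^ n - z ^ n - dpow z n * h - d2pow z n * (h * h)) in *.
    replace ((z + h) ^ S n - z ^ S n - dpow z (S n) * h - d2pow z (S n) * (h * h))
      with ((z + h) * T + d2pow z n * (h * h * h)) by (unfold T; simpl; ring).
    set (h3 := (Cmod h * Cmod h * Cmod h)%R) in *.
    assert (Hh3 : (0 <= h3)%R) by (unfold h3; repeat apply Rmult_le_pos; lra).
    assert (HP := pow_le (Cmod z + del) n ltac:(lra)).
    set (P := ((Cmod z + del) ^ n)%R) in *.
    assert (H1 : (Cmod ((z + h) * T + d2pow z n * (h * h * h))
                  <= (Cmod z + del / 2) * Cmod T + Cmod (d2pow z n) * h3)%R).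
    { eapply Rle_trans; [apply Cmod_triangle |].
      rewrite (Cmod_mult (z + h)), (Cmod_mult (d2pow z n)), !(Cmod_mult _ h); fold h3.
      apply Rplus_le_compat_r, Rmult_le_compat_r; [apply Cmod_ge_0 |].
      eapply Rle_trans; [apply Cmod_triangle | lra]. }
    assert (H2 : (Cmod (d2pow z n) * (del * del) * (h3 * del) <= P * (h3 * del))%R).
    { apply Rmult_le_compat_r; [nra | now apply Cmod_d2pow_le]. }
    assert (H3 : ((Cmod z + del / 2) * (Cmod T * (del * del * del))
                  <= (Cmod z + del / 2) * (2 * h3 * P))%R).
    { apply Rmult_le_compat_l; [lra | exact IH]. }
    assert (Hd3 : (0 <= del * del * del)%R) by (repeat apply Rmult_le_pos; lra).
    assert (H4 := Rmult_le_compat_r _ _ _ Hd3 H1).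
    simpl; fold P.
    apply Rle_trans with (1 := H4).
    apply Rle_trans with ((Cmod z + del / 2) * (2 * h3 * P) + P * (h3 * del))%R; [lra |].
    right; field.
Qed.

Lemma Cmod_series_le (b : nat -> C) (l : C) (c : nat -> R) (L : R) :
  @is_series C_AbsRing C_NormedModule b l -> is_series c L ->
  (forall n, (Cmod (b n) <= c n)%R) -> (Cmod l <= L)%R.
Proof.
  intros Hb Hc Hle.
  assert (H1 : is_lim_seq (fun n => norm (sum_n b n)) (Cmod l)).
  { exact (filterlim_comp _ _ _ _ _ _ _ _ Hb (filterlim_norm (V := C_NormedModule) l)). }
  assert (H2 : is_lim_seq (sum_n c) L) by exact Hc.
  apply (is_lim_seq_le _ _ (Cmod l) L) with (2 := H1) (3 := H2); intros n.
  apply Rle_trans with (1 := norm_sum_n_m (V := C_NormedModule) b 0 n).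
  apply sum_n_m_le; exact Hle.
Qed.

Lemma pseries_coeff_bound (a : nat -> C) (rho : R) (l : C) :
  (0 <= rho)%R -> @is_pseries C_AbsRing C_NormedModule a (RtoC rho) l ->
  exists A, forall n, (Cmod (a n) * rho ^ n <= A)%R.
Proof.
  intros Hrho Hs.
  destruct (filterlim_bounded _ (ex_intro _ l Hs)) as [M HM].
  (* Each term is a difference of two partial sums, all bounded by [M]. *)
  exists (2 * M)%R; intros n.
  assert (Hn : (Cmod (a n) * rho ^ n)%R
    = norm (V := C_NormedModule) (scal (pow_n (K := C_Ring) (RtoC rho) n) (a n))).
  { rewrite pow_n_Cpow; change (norm (V := C_NormedModule) (scal (RtoC rho ^ n) (a n)))
      with (Cmod (RtoC rho ^ n * a n)).
    rewrite Cmod_mult, Cmod_pow, Cmod_R, Rabs_pos_eq by exact Hrho; ring. }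
  rewrite Hn.
  destruct n as [| n].
  - assert (T := HM O); rewrite sum_O in T.
    assert (T' := Rle_trans _ _ _ (norm_ge_0 _) T).
    apply Rle_trans with M; [exact T | lra].
  - assert (T := HM (S n)); assert (T' := HM n); rewrite sum_Sn in T.
    assert (Hsub : forall s u : C, (Cmod s <= M)%R -> (Cmod (s + u) <= M)%R ->
      (Cmod u <= 2 * M)%R).
    { intros s u Hs1 Hs2; assert (T2 := Cmod_triangle (s + u) (- s)).
      replace (s + u + - s) with u in T2 by ring; rewrite Cmod_opp in T2; lra. }
    exact (Hsub _ _ T' T).
Qed.

(** Each power is expanded to second order, and the three families of terms are dominated by one
    geometric series. The series for [B] is kept in the conclusion so that the derivative at [0] can
    be read off the coefficients. *)
Lemma pseries_jet2 (a : nat -> C) (F : C -> C) (z0 : C) :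
  (forall z, (Cmod z < 1)%R -> @is_pseries C_AbsRing C_NormedModule a z (F z)) ->
  (Cmod z0 < 1)%R ->
  exists B, jet2 F z0 B /\
    @is_series C_AbsRing C_NormedModule (fun n => dpow z0 n * a n) B.
Proof.
  intros HF Hz0; assert (Hz := Cmod_ge_0 z0).
  set (del := ((1 - Cmod z0) / 4)%R).
  assert (Hdel : (0 < del)%R) by (unfold del; lra).
  (* Convergence at [rho < 1] bounds the coefficients, the power estimates grow like [s ^ n], and
     [q = s / rho < 1] is the resulting ratio. *)
  set (s := (Cmod z0 + del)%R); set (rho := (Cmod z0 + 2 * del)%R).
  assert (Hs : (0 < s < rho)%R) by (unfold s, rho; lra).
  assert (Hrho : (rho < 1)%R) by (unfold rho, del; lra).
  destruct (pseries_coeff_bound a rho (F rho)) as [A HA]; [lra | |].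
  { apply HF; rewrite Cmod_R, Rabs_pos_eq; lra. }
  set (q := (s / rho)%R).
  assert (Hq : (0 <= q < 1)%R).
  { unfold q; split; [apply Rlt_le, Rdiv_lt_0_compat; lra |].
    apply (Rmult_lt_reg_r rho); [lra |]; unfold Rdiv.
    rewrite Rmult_assoc, Rinv_l, Rmult_1_r by lra; lra. }
  assert (HAq : forall n, (Cmod (a n) * s ^ n <= A * q ^ n)%R).
  { intros n; unfold q, Rdiv; rewrite Rpow_mult_distr, pow_inv.
    assert (T := pow_lt rho n ltac:(lra)); assert (T' := pow_le s n ltac:(lra)).
    replace (Cmod (a n) * s ^ n)%R with (Cmod (a n) * rho ^ n * (s ^ n * / rho ^ n))%R
      by (field; lra).
    apply Rmult_le_compat_r; [| apply HA].
    apply Rmult_le_pos; [lra | left; now apply Rinv_0_lt_compat]. }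
  set (L := (A * / (1 - q))%R).
  assert (HL : is_series (fun n => A * q ^ n)%R L).
  { apply (is_series_scal (V := R_NormedModule) A (fun n => q ^ n)%R).
    apply is_series_geom; rewrite Rabs_pos_eq; lra. }
  assert (Hser : forall (D : nat -> C) (k : R), (0 < k)%R ->
    (forall n, (Cmod (D n) * k <= s ^ n)%R) ->
    exists S, @is_series C_AbsRing C_NormedModule (fun n => D n * a n) S).
  { intros D k Hk HD.
    apply (ex_series_le (V := C_CompleteNormedModule) _ (fun n => / k * (A * q ^ n))%R).
    - intros n; change (Cmod (D n * a n) <= / k * (A * q ^ n))%R.
      rewrite Cmod_mult.
      apply (Rmult_le_reg_l k); [exact Hk |].
      replace (k * (/ k * (A * q ^ n)))%R with (A * q ^ n)%R by (field; lra).
      assert (T := Rmult_le_compat_r _ _ _ (Cmod_ge_0 (a n)) (HD n)).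
      specialize (HAq n); lra.
    - exists (/ k * L)%R; exact (is_series_scal (V := R_NormedModule) (/ k)%R _ _ HL). }
  destruct (Hser (dpow z0) del Hdel) as [B HB].
  { intros n; now apply Cmod_dpow_le. }
  destruct (Hser (d2pow z0) (del * del)%R) as [Q HQ].
  { nra. } { intros n; now apply Cmod_d2pow_le. }
  exists B; split; [| exact HB].
  assert (Hrem : forall h, (Cmod h <= del / 2)%R ->
    (Cmod (F (z0 + h)%C - F z0 - B * h - Q * (h * h))
     <= 2 * (Cmod h * Cmod h * Cmod h) / (del * del * del) * L)%R).
  { intros h Hh.
    assert (Hd3 : (0 < del * del * del)%R) by (repeat apply Rmult_lt_0_compat; lra).
    apply (Cmod_series_le
      (fun n => ((z0 + h) ^ n - z0 ^ n - dpow z0 n * h - d2pow z0 n * (h * h)) * a n) _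
      (fun n => 2 * (Cmod h * Cmod h * Cmod h) / (del * del * del) * (A * q ^ n))%R).
    - assert (H1 : @is_pseries C_AbsRing C_NormedModule a (z0 + h) (F (z0 + h))).
      { apply HF; eapply Rle_lt_trans; [apply Cmod_triangle |]; unfold del in *; lra. }
      assert (H2 := HF z0 Hz0).
      assert (H3 := is_series_scal (V := C_NormedModule) h _ _ HB).
      assert (H4 := is_series_scal (V := C_NormedModule) (h * h) _ _ HQ).
      assert (H5 := is_series_minus _ _ _ _
        (is_series_minus _ _ _ _ (is_series_minus _ _ _ _ H1 H2) H3) H4).
      replace (F (z0 + h) - F z0 - B * h - Q * (h * h)) with
        (F (z0 + h) - F z0 - h * B - h * h * Q) by ring.
      refine (is_series_ext _ _ _ _ H5); intros n; simpl.
      rewrite !pow_n_Cpow.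
      change (((z0 + h) ^ n * a n - z0 ^ n * a n - h * (dpow z0 n * a n)
                - h * h * (d2pow z0 n * a n))
        = ((z0 + h) ^ n - z0 ^ n - dpow z0 n * h - d2pow z0 n * (h * h)) * a n).
      ring.
    - exact (is_series_scal (V := R_NormedModule) _ _ _ HL).
    - intros n; rewrite Cmod_mult.
      assert (T := Cmod_pow_remainder_le z0 h del n Hdel Hh); fold s in T.
      set (h3 := (Cmod h * Cmod h * Cmod h)%R) in *.
      assert (Hh3 : (0 <= h3)%R) by (unfold h3; assert (T' := Cmod_ge_0 h); repeat apply Rmult_le_pos; lra).
      apply (Rmult_le_reg_r (del * del * del)); [exact Hd3 |].
      replace (2 * h3 / (del * del * del) * (A * q ^ n) * (del * del * del))%R
        with (2 * h3 * (A * q ^ n))%R by (field; lra).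
      assert (T1 := Rmult_le_compat_r _ _ _ (Cmod_ge_0 (a n)) T).
      assert (T2 : (2 * h3 * (Cmod (a n) * s ^ n) <= 2 * h3 * (A * q ^ n))%R)
        by (apply Rmult_le_compat_l; [lra | apply HAq]).
      lra. }
  (* The expansion holds by definition of [E]; [Hrem] supplies the continuity of [E] at [z0]. *)
  set (E := fun z => if Ceq_dec z z0 then Q
    else (F z - F z0 - B * (z - z0)) / ((z - z0) * (z - z0))).
  exists E; split.
  - apply continuous_Cmod; intros eps Heps.
    set (K := (2 / (del * del * del) * L)%R).
    assert (HK : (0 < Rabs K + 1)%R) by (assert (T := Rabs_pos K); lra).
    exists (Rmin (del / 2) (eps / (Rabs K + 1))); split.
    { apply Rmin_pos; [lra | now apply Rdiv_lt_0_compat]. }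
    intros y Hy.
    assert (Hy1 := Rlt_le_trans _ _ _ Hy (Rmin_l _ _)).
    assert (Hy2 := Rlt_le_trans _ _ _ Hy (Rmin_r _ _)).
    unfold E; destruct (Ceq_dec z0 z0) as [_ | n]; [| now elim n].
    destruct (Ceq_dec y z0) as [-> | Hn].
    { replace (Q - Q) with (RtoC 0) by ring; rewrite Cmod_0; exact Heps. }
    assert (Hh0 : y - z0 <> 0) by now apply Cminus_eq_contra.
    assert (T := Hrem (y - z0) ltac:(lra)).
    replace (z0 + (y - z0)) with y in T by ring.
    set (h := y - z0) in *.
    assert (Hhp := proj1 (Cmod_gt_0 h) Hh0).
    replace ((F y - F z0 - B * h) / (h * h) - Q)
      with ((F y - F z0 - B * h - Q * (h * h)) / (h * h)) by (field; exact Hh0).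
    rewrite Cmod_div, Cmod_mult by now apply Cmult_neq_0.
    apply Rle_lt_trans with ((Rabs K + 1) * Cmod h)%R.
    + assert (Hhh : (0 < Cmod h * Cmod h)%R) by now apply Rmult_lt_0_compat.
      apply (Rmult_le_reg_r (Cmod h * Cmod h)); [exact Hhh |].
      unfold Rdiv at 1; rewrite Rmult_assoc, Rinv_l, Rmult_1_r by lra.
      apply Rle_trans with (1 := T).
      replace (2 * (Cmod h * Cmod h * Cmod h) / (del * del * del) * L)%R
        with (K * (Cmod h * Cmod h * Cmod h))%R by (unfold K; field; lra).
      replace ((Rabs K + 1) * Cmod h * (Cmod h * Cmod h))%R
        with ((Rabs K + 1) * (Cmod h * Cmod h * Cmod h))%R by ring.
      apply Rmult_le_compat_r; [apply Rmult_le_pos; lra |].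
      assert (T' := Rle_abs K); lra.
    + replace eps with ((Rabs K + 1) * (eps / (Rabs K + 1)))%R by (field; lra).
      now apply Rmult_lt_compat_l.
  - apply filter_forall; intros y; unfold E.
    destruct (Ceq_dec y z0) as [-> | Hn]; [Cring |].
    assert (Hh0 : y - z0 <> 0) by now apply Cminus_eq_contra.
    Cfield; exact Hh0.
Qed.

(** Since [|F z0| = 1], the one-sided derivative of [|F|] along [u] is [Re (conj (F z0) B u)]. The
    slack [s^2 K] allows an upper bound that is linear only to first order. *)
Lemma jet2_Cmod_directional (F : C -> C) (z0 B u : C) (L K s0 : R) :
  jet2 F z0 B -> Cmod (F z0) = 1%R -> (0 < s0)%R ->
  (forall s, (0 < s < s0)%R -> (Cmod (F (z0 + s * u)%C) <= 1 + s * L + s * s * K)%R) ->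
  (Re (Cconj (F z0) * B * u) <= L)%R.
Proof.
  intros [E [HE HF]] HF0 Hs0 Hle.
  destruct (Rle_lt_dec (Re (Cconj (F z0) * B * u)) L) as [H | Hgt]; [exact H | exfalso].
  assert (HEl : locally z0 (fun z : C => (Cmod (E z - E z0) < 1)%R)).
  { apply locally_Cmod, (proj1 (continuous_Cmod E z0) HE 1%R Rlt_0_1). }
  assert (H := filter_and _ _ HF HEl); apply locally_Cmod in H; destruct H as [d [Hd H]].
  set (A := F z0) in *; set (e := (Cmod (E z0) + 1)%R); set (g := (Re (Cconj A * B * u) - L)%R).
  assert (Hg : (0 < g)%R) by (unfold g; lra).
  assert (He : (0 < e)%R) by (unfold e; assert (T := Cmod_ge_0 (E z0)); lra).
  assert (Hu := Cmod_ge_0 u).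
  (* [M] collects the quadratic coefficients; a step with [s M < g] makes them too small to absorb
     the excess slope [g]. *)
  set (M := (Rabs K + e * (Cmod u * Cmod u) + 1)%R).
  assert (HM : (0 < M)%R) by (unfold M; assert (T := Rabs_pos K); nra).
  set (s := (Rmin (s0 / 2) (Rmin (d / (Cmod u + 1) / 2) (g / M / 2)))%R).
  assert (Hdu : (0 < d / (Cmod u + 1))%R) by (apply Rdiv_lt_0_compat; lra).
  assert (HgM : (0 < g / M)%R) by (apply Rdiv_lt_0_compat; lra).
  assert (Hs : (0 < s)%R) by (unfold s; repeat apply Rmin_pos; lra).
  assert (Hs1 : (s < s0)%R) by (unfold s; assert (T := Rmin_l (s0 / 2) (Rmin (d / (Cmod u + 1) / 2) (g / M / 2))); lra).
  assert (Hs23 : (s <= Rmin (d / (Cmod u + 1) / 2) (g / M / 2))%R) by apply Rmin_r.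
  assert (Hs2 := Rle_trans _ _ _ Hs23 (Rmin_l _ _)).
  assert (Hs3 := Rle_trans _ _ _ Hs23 (Rmin_r _ _)).
  assert (Hsu : Cmod (s * u) = (s * Cmod u)%R) by (rewrite Cmod_mult, Cmod_R, Rabs_pos_eq; lra).
  assert (Hsud : (s * Cmod u < d)%R).
  { assert (T : (s * (Cmod u + 1) <= d / (Cmod u + 1) / 2 * (Cmod u + 1))%R)
      by (apply Rmult_le_compat_r; lra).
    replace (d / (Cmod u + 1) / 2 * (Cmod u + 1))%R with (d / 2)%R in T by (field; lra). nra. }
  assert (HsM : (s * M < g)%R).
  { assert (T : (s * M <= g / M / 2 * M)%R) by (apply Rmult_le_compat_r; lra).
    replace (g / M / 2 * M)%R with (g / 2)%R in T by (field; lra). lra. }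
  assert (Hzu : z0 + s * u - z0 = s * u) by ring.
  destruct (H (z0 + s * u)) as [H1 H2]; [rewrite Hzu, Hsu; exact Hsud |].
  rewrite Hzu in H1.
  assert (HEb : (Cmod (E (z0 + s * u)%C) <= e)%R).
  { assert (T := Cmod_triangle (E (z0 + s * u) - E z0) (E z0)).
    replace (E (z0 + s * u) - E z0 + E z0) with (E (z0 + s * u)) in T by ring.
    unfold e; lra. }
  set (Y := E (z0 + s * u) * (s * u * (s * u))) in *.
  assert (HY : (Cmod Y <= e * (Cmod u * Cmod u) * (s * s))%R).
  { unfold Y; rewrite Cmod_mult, (Cmod_mult (s * u)), Hsu.
    replace (e * (Cmod u * Cmod u) * (s * s))%R with (e * (s * Cmod u * (s * Cmod u)))%R by ring.
    apply Rmult_le_compat_r; [nra | exact HEb]. }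
  assert (HcY : (- (e * (Cmod u * Cmod u) * (s * s)) <= Re (Cconj A * Y))%R).
  { assert (T := re_le_Cmod (Cconj A * Y)).
    rewrite Cmod_mult, Cmod_Cconj, HF0, Rmult_1_l in T.
    apply Rabs_le_between in T; lra. }
  assert (HcF : (Re (Cconj A * F (z0 + s * u)%C) <= Cmod (F (z0 + s * u)%C))%R).
  { assert (T := re_le_Cmod (Cconj A * F (z0 + s * u))).
    rewrite Cmod_mult, Cmod_Cconj, HF0, Rmult_1_l in T.
    apply Rabs_le_between in T; lra. }
  assert (Hexp : Re (Cconj A * F (z0 + s * u)%C)
    = (1 + s * Re (Cconj A * B * u) + Re (Cconj A * Y))%R).
  { rewrite H1.
    assert (T : (Re A * Re A + Im A * Im A = 1)%R) by (rewrite <- Cmod_sqr, HF0; ring).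
    rewrite <- T; clearbody Y; destruct A, B, u, Y; simpl; ring. }
  assert (Hls := Hle s (conj Hs Hs1)).
  assert (HKs : (s * s * K <= s * s * Rabs K)%R).
  { apply Rmult_le_compat_l; [nra | apply Rle_abs]. }
  assert (Hfin : (s * g <= s * (s * M))%R) by (unfold g, M; nra).
  apply Rmult_le_reg_l in Hfin; lra.
Qed.

(** * The first boundary point *)

(* The numerator of [U_f] for [g = (1 - b w) / (1 - w)] and [z w' = k w]; the denominator is
   [(1 - b w)^3].  With [u = Re w] and [d = k (1 - b) - (1 + b)], the difference of the squared
   moduli is the explicit nonnegative expression [Hdiff]. *)
Lemma U_numerator_ge (b k : R) (w : C) :
  Cmod w = 1%R -> (0 <= b < 1)%R -> (1 + b <= k * (1 - b))%R ->
  (Cmod ((1 - b * w) * ((1 - b * w) * (1 - b * w)))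
   <= Cmod ((1 - w) * (1 - w) * (1 - b * w) + 2 * k * (1 - b) * w * (1 - w)
            - (1 - b * w) * ((1 - b * w) * (1 - b * w))))%R.
Proof.
  intros Hw Hb Hk.
  set (d := (k * (1 - b) - (1 + b))%R).
  assert (Hd : (0 <= d)%R) by (unfold d; lra).
  replace ((1 - w) * (1 - w) * (1 - b * w) + 2 * k * (1 - b) * w * (1 - w)
            - (1 - b * w) * ((1 - b * w) * (1 - b * w)))
    with (w * (4 * b - (1 + 3 * b * b) * w - b * (1 - b * b) * (w * w) + 2 * d * (1 - w))).
  2:{ replace (RtoC d) with (k * (1 - b) - (1 + b))
        by (unfold d; now rewrite RtoC_minus, RtoC_mult, RtoC_minus, RtoC_plus). ring. }
  rewrite (Cmod_mult w), Hw, Rmult_1_l.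
  apply Rsqr_incr_0_var; [| apply Cmod_ge_0]; unfold Rsqr.
  assert (Hw2 : (Re w * Re w + Im w * Im w = 1)%R) by (rewrite <- Cmod_sqr, Hw; ring).
  rewrite !Cmod_sqr; destruct w as [u v]; simpl in Hw2 |- *.
  assert (Hv : (v * v = 1 - u * u)%R) by lra.
  assert (Hu : (-1 <= u <= 1)%R) by nra.
  assert (Hdiff : (0 <= (1 - u * u) * (4 * (b * b) * (7 - b * b - 2 * b * u))
     + 4 * d * ((1 - u) * (4 * b + (1 + 3 * b * b) + b * (1 - b * b) * (1 + 2 * u)))
     + 8 * (d * d) * (1 - u))%R).
  { assert (H1 : (0 <= (1 - u * u) * (4 * (b * b) * (7 - b * b - 2 * b * u)))%R).
    { repeat apply Rmult_le_pos; nra. }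
    assert (H2 : (0 <= 4 * d * ((1 - u) * (4 * b + (1 + 3 * b * b) + b * (1 - b * b) * (1 + 2 * u))))%R).
    { apply Rmult_le_pos; [lra |]; apply Rmult_le_pos; [lra |].
      assert (0 <= b * (1 - b * b) <= b)%R by nra. nra. }
    assert (H3 : (0 <= 8 * (d * d) * (1 - u))%R) by (apply Rmult_le_pos; nra).
    lra. }
  apply Rminus_le; apply Ropp_le_cancel; rewrite Ropp_0.
  eapply Rle_trans; [exact Hdiff |]; right.
  assert (Hv2 : (v ^ 2 = 1 - u * u)%R) by (simpl; lra).
  ring [Hv2].
Qed.

(** The points of modulus at most [|z1|] with [Re g <= m] form a compact set; [z0] maximises [-|z|]
    on it. *)
Lemma first_exit (g : C -> C) (m : R) (z1 : C) :
  (forall z, in_disk z -> continuous g z) ->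
  in_disk z1 -> (Re (g z1) <= m)%R ->
  exists z0, in_disk z0 /\ (Re (g z0) <= m)%R /\
    forall y, (Cmod y < Cmod z0)%R -> (m < Re (g y))%R.
Proof.
  intros Hg Hz1 Hm; unfold in_disk in *.
  destruct (closed_bounded_attains_max
    (fun z => (Cmod z <= Cmod z1)%R /\ (Re (g z) <= m)%R) (fun z => (- Cmod z)%R) (Cmod z1))
    as [z0 [[Hz0 Hm0] Hmin]].
  - tauto.
  - intros z Hz; destruct (Rle_lt_dec (Cmod z) (Cmod z1)) as [Hle | Hlt].
    + assert (Hgz : (m < Re (g z))%R) by (apply Rnot_le_lt; tauto).
      destruct (proj1 (continuous_Cmod g z) (Hg z ltac:(lra)) (Re (g z) - m)%R)
        as [d [Hd H]]; [lra |].
      apply locally_Cmod; exists d; split; [exact Hd |]; intros y Hy [_ Hy2].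
      assert (T := Rle_lt_trans _ _ _ (re_le_Cmod _) (H y Hy)).
      apply Rabs_lt_between in T; simpl in T; unfold Re in *; lra.
    + apply locally_Cmod; exists (Cmod z - Cmod z1)%R; split; [lra |].
      intros x Hx [Hxr _].
      assert (T := Cmod_triangle x (- (x - z))).
      replace (x + - (x - z)) with z in T by ring; rewrite Cmod_opp in T; lra.
  - intros z _ eps Heps; apply locally_Cmod; exists eps; split; [exact Heps |].
    intros y Hy.
    assert (T := Cmod_triangle y (- (y - z))).
    replace (y + - (y - z)) with z in T by ring; rewrite Cmod_opp in T; lra.
  - exists z1; split; lra.
  - exists z0; split; [lra |]; split; [exact Hm0 |].
    intros y Hy; apply Rnot_le_lt; intros Hym.
    assert (Hy1 : (Cmod y <= Cmod z1)%R) by lra.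
    assert (T := Hmin y (conj Hy1 Hym)); lra.
Qed.

(** * Derivatives of [f] and of [f(z)/z] *)

Lemma is_series_dpow_0 (a : nat -> C) :
  @is_series C_AbsRing C_NormedModule (fun n => dpow 0 n * a n) (a 1%nat).
Proof.
  assert (Hsum : forall n,
    @sum_n C_AbelianMonoid (fun n => dpow 0 n * a n) (S n) = a 1%nat).
  { intros n; induction n as [| n IH].
    - rewrite sum_Sn, sum_O; change (dpow 0 0 * a 0%nat + dpow 0 1 * a 1%nat = a 1%nat).
      simpl; ring.
    - rewrite sum_Sn, IH; change (a 1%nat + dpow 0 (S (S n)) * a (S (S n)) = a 1%nat).
      simpl; ring. }
  unfold is_series; apply filterlim_ext_loc with (fun _ : nat => a 1%nat).
  - exists 1%nat; intros [| n] Hn; [lia |]; symmetry; apply Hsum.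
  - apply filterlim_const.
Qed.

Lemma is_pseries_div_id (f : C -> C) (a : nat -> C) :
  classA f a -> forall z, in_disk z ->
  @is_pseries C_AbsRing C_NormedModule (PS_decr_1 a) z (if Ceq_dec z 0 then RtoC 1 else f z / z).
Proof.
  intros [Ha0 [Ha1 Hf]] z Hz.
  destruct (Ceq_dec z 0) as [-> | Hz0].
  - rewrite <- Ha1; exact (is_pseries_0 (V := C_NormedModule) (PS_decr_1 a)).
  - assert (H := is_pseries_decr_1 (V := C_NormedModule) a z (/ z) (f z) (Cinv_l z Hz0) (Hf z Hz)).
    replace (f z / z) with (/ z * (f z + - a 0%nat)) by (rewrite Ha0; field; exact Hz0).
    exact H.
Qed.

(** Identifies the derivative supplied by [classU1] with the one computed by the jet calculus. *)
Lemma jet2_has_cderiv (f : C -> C) (z B d : C) : jet2 f z B -> has_cderiv f z d -> d = B.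
Proof.
  intros [E [HE HF]] [_ Hder].
  assert (HEl : locally z (fun y : C => (Cmod (E y - E z) < 1)%R)).
  { apply locally_Cmod, (proj1 (continuous_Cmod E z) HE 1%R Rlt_0_1). }
  destruct (Ceq_dec d B) as [Heq | Hn]; [exact Heq | exfalso].
  assert (Hdb := proj1 (Cmod_gt_0 (d - B)) (Cminus_eq_contra _ _ Hn)).
  set (g := Cmod (d - B)) in *.
  assert (Hg2 : (0 < g / 2)%R) by lra.
  assert (Hd := Hder z (fun P HP => HP) (mkposreal _ Hg2)).
  apply locally_C in Hd.
  assert (H := filter_and _ _ (filter_and _ _ HF HEl) Hd).
  apply locally_Cmod in H; destruct H as [r [Hr H]].
  set (e := (Cmod (E z) + 1)%R).
  assert (He : (0 < e)%R) by (unfold e; assert (T := Cmod_ge_0 (E z)); lra).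
  (* For this increment [g h <= (g / 2) h + e h^2 <= (3 / 4) g h], which is impossible for
     [g > 0]. *)
  set (h := (Rmin (r / 2) (g / e / 4))%R).
  assert (Hge : (0 < g / e)%R) by (apply Rdiv_lt_0_compat; lra).
  assert (Hh : (0 < h)%R) by (unfold h; apply Rmin_pos; lra).
  assert (Hh1 : (h < r)%R) by (unfold h; assert (T := Rmin_l (r / 2) (g / e / 4)); lra).
  assert (Hh2 : (h * e <= g / 4)%R).
  { assert (T := Rmult_le_compat_r e _ _ ltac:(lra) (Rmin_r (r / 2) (g / e / 4))).
    replace (g / e / 4 * e)%R with (g / 4)%R in T by (field; lra). exact T. }
  assert (Hzh : z + h - z = h) by ring.
  assert (Hch : Cmod h = h) by (rewrite Cmod_R, Rabs_pos_eq; lra).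
  destruct (H (z + h)) as [[H1 H2] H3]; [rewrite Hzh, Hch; exact Hh1 |].
  rewrite Hzh in H1.
  change (Cmod (f (z + h)%C - f z - (z + h - z) * d) <= g / 2 * Cmod (z + h - z))%R in H3.
  rewrite Hzh, Hch in H3.
  assert (HEb : (Cmod (E (z + h)%C) <= e)%R).
  { assert (T := Cmod_triangle (E (z + h) - E z) (E z)).
    replace (E (z + h) - E z + E z) with (E (z + h)) in T by ring.
    unfold e; lra. }
  assert (T := Cmod_triangle (- (f (z + h) - f z - h * d)) (E (z + h) * (h * h))).
  replace (- (f (z + h) - f z - h * d) + E (z + h) * (h * h)) with (h * (d - B)) in T
    by (rewrite H1; ring).
  rewrite Cmod_opp, !Cmod_mult, Hch in T; fold g in T.
  assert (HEh : (Cmod (E (z + h)%C) * (h * h) <= e * (h * h))%R)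
    by (apply Rmult_le_compat_r; nra).
  nra.
Qed.

(* [1 - (1 - b) / (g - b) = (g - 1) / (g - b)], written so that [g] occurs only once. *)
Lemma halfplane_to_disk (b : R) (g : C) :
  (b < 1)%R -> ((1 + b) / 2 <= Re g)%R ->
  (Cmod (1 + - (1 - b) * / (g + - b)) <= 1)%R /\
  (Re g = (1 + b) / 2 -> Cmod (1 + - (1 - b) * / (g + - b)) = 1)%R.
Proof.
  intros Hb Hg.
  assert (Hne : g + - b <> 0).
  { intros H; apply (f_equal Re) in H; destruct g; simpl in *; lra. }
  assert (Hp := proj1 (Cmod_gt_0 _) Hne).
  replace (1 + - (1 - b) * / (g + - b)) with ((g - 1) / (g + - b)) by (field; exact Hne).
  rewrite Cmod_div by exact Hne.
  assert (Hid : (Cmod (g + - b) * Cmod (g + - b) - Cmod (g - 1) * Cmod (g - 1)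
    = (1 - b) * (2 * Re g - (1 + b)))%R).
  { rewrite !Cmod_sqr; destruct g; simpl; ring. }
  assert (Hn := Cmod_ge_0 (g - 1)).
  split.
  - apply (Rmult_le_reg_r (Cmod (g + - b))); [exact Hp |].
    unfold Rdiv; rewrite Rmult_assoc, Rinv_l, Rmult_1_r, Rmult_1_l by lra.
    apply Rsqr_incr_0_var; [unfold Rsqr; nra | lra].
  - intros Heq; replace (Cmod (g - 1)) with (Cmod (g + - b)); [field; lra |].
    rewrite Heq in Hid.
    apply Rsqr_inj; [lra | lra | unfold Rsqr; lra].
Qed.

(** The whole argument for one half-plane. The first alternative on [b] says [|w'(0)| <= c] for the
    [c] of the Schwarz-Pick bound; the second is the case [c = 1], which holds for every [a_2]. *)
Lemma re_g_gt (f : C -> C) (a : nat -> C) (g : C -> C) (b : R) :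
  classU1 f a ->
  (forall z, in_disk z -> continuous g z) ->
  g 0 = 1 ->
  (forall z, in_disk z -> z <> 0 -> g z * g z = f z / z) ->
  (0 <= b <= 1 / 3)%R ->
  (Cmod (a 2%nat) * (1 + b) <= 2 * (1 - b) * (1 - 3 * b))%R \/ b = 0%R ->
  forall z, in_disk z -> ((1 + b) / 2 < Re (g z))%R.
Proof.
  intros [HA [Hf0 HU]] Hg Hg0 Hgf Hb Hab z1 Hz1.
  destruct (Rle_lt_dec (Re (g z1)) ((1 + b) / 2)) as [Hle | Hlt]; [exfalso | exact Hlt].
  destruct (first_exit g _ z1 Hg Hz1 Hle) as [z0 [Hz0 [Hgz0 Hin]]]; clear z1 Hz1 Hle.
  unfold in_disk in *.
  assert (Hz0n : z0 <> 0).
  { intros ->; rewrite Hg0 in Hgz0; simpl in Hgz0; lra. }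
  assert (Hr := proj1 (Cmod_gt_0 z0) Hz0n); set (r := Cmod z0) in *.
  (* If [Re (g z0)] were strictly smaller, continuity would keep it so at [(1 - s) z0], which lies
     in the smaller disk. *)
  assert (Hgz0' : Re (g z0) = ((1 + b) / 2)%R).
  { apply Rle_antisym; [exact Hgz0 |].
    apply Rnot_lt_le; intros Hlt.
    destruct (proj1 (continuous_Cmod g z0) (Hg z0 Hz0) ((1 + b) / 2 - Re (g z0))%R)
      as [d [Hd H]]; [lra |].
    set (s := (Rmin (d / 2) (r / 2) / r)%R).
    assert (Hs0 : (0 < Rmin (d / 2) (r / 2))%R) by (apply Rmin_pos; lra).
    assert (Hs1 : (0 < s)%R) by (now apply Rdiv_lt_0_compat).
    assert (Hsr : (s * r)%R = Rmin (d / 2) (r / 2)) by (unfold s; field; lra).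
    assert (Hs2 : (s * r <= d / 2)%R) by (rewrite Hsr; apply Rmin_l).
    assert (Hs3 : (s * r <= r / 2)%R) by (rewrite Hsr; apply Rmin_r).
    assert (Hs4 : (s <= 1 / 2)%R) by nra.
    assert (H1 : (Cmod (RtoC (1 - s) * z0 - z0) < d)%R).
    { replace (RtoC (1 - s) * z0 - z0) with (- (s * z0)) by (rewrite RtoC_minus; ring).
      rewrite Cmod_opp, Cmod_mult, Cmod_R, Rabs_pos_eq by lra. fold r; lra. }
    assert (H2 := Rle_lt_trans _ _ _ (re_le_Cmod _) (H _ H1)).
    assert (H3 : ((1 + b) / 2 < Re (g (RtoC (1 - s) * z0)%C))%R).
    { apply Hin; rewrite Cmod_mult, Cmod_R, Rabs_pos_eq by lra; fold r; nra. }
    apply Rabs_lt_between in H2; simpl in H2; unfold Re in *; lra. }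
  assert (HHg : forall z, (Cmod z < 1)%R -> g z * g z = if Ceq_dec z 0 then 1 else f z / z).
  { intros z Hz; destruct (Ceq_dec z 0) as [-> | Hn]; [rewrite Hg0; ring | now apply Hgf]. }
  assert (Hgn : forall z, (Cmod z < 1)%R -> g z <> 0).
  { intros z Hz Hgz; assert (T := HHg z Hz); rewrite Hgz, Cmult_0_l in T.
    destruct (Ceq_dec z 0) as [-> | Hn].
    - injection T; lra.
    - apply (Hf0 z Hz Hn).
      replace (f z) with (f z / z * z) by (field; exact Hn).
      rewrite <- T; ring. }
  assert (Hgjet : forall z, (Cmod z < 1)%R -> exists B, jet2 g z B /\ (z = 0 -> B = a 2%nat / 2)).
  { intros z Hz.
    destruct (pseries_jet2 _ _ z (is_pseries_div_id f a HA) Hz) as [B [HB HBs]].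
    exists (B / (2 * g z)); split.
    - refine (jet2_sqrt _ _ _ _ (Hg z Hz) _ (Hgn z Hz) HB).
      apply locally_Cmod; exists (1 - Cmod z)%R; split; [lra |].
      intros y Hy; apply HHg.
      assert (T := Cmod_triangle z (y - z)); replace (z + (y - z)) with y in T by ring; lra.
    - intros ->; rewrite Hg0.
      rewrite (filterlim_locally_unique (V := C_NormedModule) _ _ _ HBs
                 (is_series_dpow_0 (PS_decr_1 a))).
      unfold PS_decr_1; field. }
  set (w := fun z => 1 + - (1 - b) * / (g z + - b)).
  assert (Hgb : forall z, ((1 + b) / 2 <= Re (g z))%R -> g z + - b <> 0).
  { intros z Hz H; apply (f_equal Re) in H; simpl in *; unfold Re in *; lra. }
  assert (Hwjet : forall z B, ((1 + b) / 2 <= Re (g z))%R -> jet2 g z B ->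
    jet2 w z ((1 - b) * B / ((g z + - b) * (g z + - b)))).
  { intros z B Hz HB.
    replace ((1 - b) * B / ((g z + - b) * (g z + - b)))
      with (0 + (0 * / (g z + - b) + - (1 - b) * (- (B + 0) / ((g z + - b) * (g z + - b)))))
      by (field; now apply Hgb).
    apply (jet2_plus (fun _ => RtoC 1)); [apply jet2_const |].
    apply (jet2_mult (fun _ => - (1 - b)) (fun z => / (g z + - b))); [apply jet2_const |].
    apply (jet2_inv (fun z => g z + - b)); [| now apply Hgb].
    apply (jet2_plus g (fun _ => - b)); [exact HB | apply jet2_const]. }
  assert (Hb1 : 1 - b <> 0).
  { rewrite <- RtoC_minus; intros H; injection H; lra. }
  assert (Hw0 : w 0 = 0) by (unfold w; rewrite Hg0; field; exact Hb1).
  assert (Hin' : forall y, (Cmod y < r)%R -> ((1 + b) / 2 <= Re (g y))%R).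
  { intros y Hy; left; now apply Hin. }
  (* Chosen so that [2 / (1 + c) = (1 + b) / (1 - b)]; the range of [b] puts it in [[0, 1]]. *)
  set (c := ((1 - 3 * b) / (1 + b))%R).
  assert (Hc0 : (0 <= c)%R).
  { apply Rmult_le_pos; [lra |]; left; apply Rinv_0_lt_compat; lra. }
  assert (Hc1 : (c <= 1)%R).
  { apply (Rmult_le_reg_r (1 + b)); [lra |]; unfold c, Rdiv.
    rewrite Rmult_assoc, Rinv_l by lra; lra. }
  destruct (Hgjet 0) as [B0 [HB0 HB0a]]; [rewrite Cmod_0; lra |].
  specialize (HB0a eq_refl).
  assert (HSP : forall z : C, z <> 0 -> (Cmod z < r)%R ->
    (Cmod (w z) * (1 + c * (Cmod z / r)) <= Cmod z / r * (Cmod z / r + c))%R).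
  { assert (Hg00 : ((1 + b) / 2 <= Re (g 0%C))%R) by (rewrite Hg0; simpl; lra).
    apply (schwarz_pick w r c _ Hw0 (Hwjet 0 B0 Hg00 HB0)); [| | | exact Hc1].
    - intros z _ Hzr; destruct (Hgjet z) as [B [HB _]]; [lra |].
      eexists; apply Hwjet; [now apply Hin' | exact HB].
    - intros z _ Hzr; apply halfplane_to_disk; [lra | now apply Hin'].
    - destruct Hab as [Hab | Hb0]; [left | right; unfold c; rewrite Hb0; field].
      rewrite Hg0, HB0a.
      replace ((1 - b) * (a 2%nat / 2) / ((1 + - b) * (1 + - b)))
        with (a 2%nat * RtoC (/ (2 * (1 - b)))).
      2:{ rewrite RtoC_inv, RtoC_mult, RtoC_minus by lra. field. exact Hb1. }
      assert (Hib : (0 < / (2 * (1 - b)))%R) by (apply Rinv_0_lt_compat; lra).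
      rewrite Cmod_mult, Cmod_R, Rabs_pos_eq by lra.
      assert (Ha2 := Cmod_ge_0 (a 2%nat)).
      apply Rle_trans with (Cmod (a 2%nat) * / (2 * (1 - b)))%R.
      { rewrite <- (Rmult_1_l (Cmod (a 2%nat) * _)) at 2.
        apply Rmult_le_compat_r; [apply Rmult_le_pos; lra | lra]. }
      apply (Rmult_le_reg_r (2 * (1 - b) * (1 + b))); [nra |].
      unfold c.
      replace (Cmod (a 2%nat) * / (2 * (1 - b)) * (2 * (1 - b) * (1 + b)))%R
        with (Cmod (a 2%nat) * (1 + b))%R by (field; lra).
      replace ((1 - 3 * b) / (1 + b) * (2 * (1 - b) * (1 + b)))%R
        with (2 * (1 - b) * (1 - 3 * b))%R by (field; lra).
      exact Hab. }
  destruct (Hgjet z0 Hz0) as [G [HG _]].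
  set (g0 := g z0) in *; set (w0 := w z0).
  assert (Hg0b : g0 + - b <> 0) by (apply Hgb; fold g0; lra).
  set (D := (1 - b) * G / ((g0 + - b) * (g0 + - b))).
  assert (HwD : jet2 w z0 D) by (apply Hwjet; [fold g0; lra | exact HG]).
  assert (Hw0m : Cmod w0 = 1%R) by (apply halfplane_to_disk; [lra | fold g0; lra | exact Hgz0']).
  (* As [|w0| = 1], this is Jack's quotient [z0 w'(z0) / w0]. *)
  set (k := Cconj w0 * D * z0).
  (* Along [(1 - s) z0] the Schwarz-Pick bound has slope [-2 / (1 + c)] at [s = 0]; [Hid] shows that
     its second-order error is at most [s^2]. *)
  assert (Hrad : (2 / (1 + c) <= Re k)%R).
  { assert (T : (Re (Cconj w0 * D * - z0) <= - (2 / (1 + c)))%R).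
    { apply (jet2_Cmod_directional w z0 D (- z0) _ 1 (1 / 2) HwD Hw0m); [lra |].
      intros s Hs.
      replace (z0 + s * - z0) with (RtoC (1 - s) * z0) by (rewrite RtoC_minus; ring).
      assert (Hm : Cmod (RtoC (1 - s) * z0) = ((1 - s) * r)%R).
      { rewrite Cmod_mult, Cmod_R, Rabs_pos_eq by lra; reflexivity. }
      assert (H := HSP (RtoC (1 - s) * z0)); rewrite Hm in H.
      replace ((1 - s) * r / r)%R with (1 - s)%R in H by (field; lra).
      assert (H' : (Cmod (w (RtoC (1 - s) * z0)%C) * (1 + c * (1 - s)) <= (1 - s) * (1 - s + c))%R).
      { apply H; [| nra]; intros H0; rewrite H0, Cmod_0 in Hm; nra. }
      clear H.
      apply (Rmult_le_reg_r (1 + c * (1 - s))); [nra |].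
      apply Rle_trans with (1 := H').
      assert (Hid : ((1 + s * - (2 / (1 + c)) + s * s * 1) * (1 + c * (1 - s))
        - (1 - s) * (1 - s + c) = s * s * (2 * c / (1 + c) + c * (1 - s)))%R)
        by (field; lra).
      assert (0 <= s * s * (2 * c / (1 + c) + c * (1 - s)))%R.
      { apply Rmult_le_pos; [nra |].
        assert (0 <= 2 * c / (1 + c))%R
          by (apply Rmult_le_pos; [lra | left; apply Rinv_0_lt_compat; lra]).
        nra. }
      lra. }
    replace (Re (Cconj w0 * D * - z0)) with (- Re k)%R in T
      by (unfold k; destruct (Cconj w0 * D), z0; simpl; ring).
    lra. }
  (* The direction [(-e + i sg) z0] is almost tangential, but its component [-e] turns it into the
     disk, where [|w| <= 1]. *)
  assert (Htan : forall e : R, (0 < e)%R -> forall sg : R, (sg * sg = 1)%R ->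
    (- e * Re k - sg * Im k <= 0)%R).
  { intros e He sg Hsg.
    assert (T : (Re (Cconj w0 * D * (((- e)%R, sg) * z0)) <= 0)%R).
    { apply (jet2_Cmod_directional w z0 D (((- e)%R, sg) * z0) 0 0 (e / (e * e + 1)) HwD Hw0m).
      { apply Rdiv_lt_0_compat; nra. }
      intros s Hs.
      assert (Hse : (s * (e * e + 1) < e)%R).
      { assert (T := Rmult_lt_compat_r (e * e + 1) _ _ ltac:(nra) (proj2 Hs)).
        replace (e / (e * e + 1) * (e * e + 1))%R with e in T by (field; nra). exact T. }
      replace (1 + s * 0 + s * s * 0)%R with 1%R by ring.
      apply halfplane_to_disk; [lra |]; apply Hin'.
      replace (z0 + s * (((- e)%R, sg) * z0)) with ((1 + s * ((- e)%R, sg)) * z0) by ring.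
      rewrite Cmod_mult; fold r.
      rewrite <- (Rmult_1_l r) at 2; apply Rmult_lt_compat_r; [exact Hr |].
      apply Rsqr_incrst_0; [| apply Cmod_ge_0 | lra].
      unfold Rsqr; rewrite Cmod_sqr; simpl. nra. }
    replace (Re (Cconj w0 * D * (((- e)%R, sg) * z0))) with (- e * Re k - sg * Im k)%R in T
      by (unfold k; destruct (Cconj w0 * D), z0; simpl; ring).
    exact T. }
  assert (Hkp : (0 < Re k)%R).
  { apply Rlt_le_trans with (2 := Hrad); apply Rdiv_lt_0_compat; lra. }
  assert (Him : Im k = 0%R).
  { destruct (Req_dec (Im k) 0) as [H | H]; [exact H | exfalso].
    assert (Hp := Rabs_pos_lt _ H).
    (* With this [e] the radial term is [|Im k| / 2], so one of the signs [sg] violates [Htan]. *)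
    set (e := (Rabs (Im k) / (2 * Re k))%R).
    assert (He : (0 < e)%R) by (apply Rdiv_lt_0_compat; lra).
    assert (HeR : (e * Re k = Rabs (Im k) / 2)%R) by (unfold e; field; lra).
    assert (T1 := Htan e He 1%R ltac:(lra)); assert (T2 := Htan e He (-1)%R ltac:(lra)).
    unfold Rabs in *; destruct (Rcase_abs (Im k)); lra. }
  set (kr := Re k).
  assert (Hk : z0 * D = kr * w0).
  { assert (H1 : k = RtoC kr).
    { unfold kr; rewrite (surjective_pairing k); unfold RtoC; simpl.
      f_equal; exact Him. }
    rewrite <- H1; unfold k.
    replace (Cconj w0 * D * z0 * w0) with (w0 * Cconj w0 * (z0 * D)) by ring.
    rewrite <- Cmod2_conj, Hw0m. simpl; rewrite !Rmult_1_l; ring. }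
  assert (Hkr : (1 + b <= kr * (1 - b))%R).
  { assert (H1 : (2 / (1 + c))%R = ((1 + b) / (1 - b))%R) by (unfold c; field; lra).
    rewrite H1 in Hrad; fold kr in Hrad.
    apply (Rmult_le_compat_r (1 - b)) in Hrad; [| lra].
    replace ((1 + b) / (1 - b) * (1 - b))%R with (1 + b)%R in Hrad by (field; lra).
    exact Hrad. }
  destruct (HU z0 Hz0 Hz0n) as [d [Hd HUd]].
  assert (Hfjet : jet2 f z0 (1 * (g0 * g0) + z0 * (G * g0 + g0 * G))).
  { apply (jet2_ext_loc (fun z => z * (g z * g z))).
    - assert (Hn := locally_neq_0 (fun z => z) z0 (continuous_id _) Hz0n).
      assert (Hd1 : locally z0 (fun z : C => (Cmod z < 1)%R)).
      { apply locally_Cmod; exists (1 - Cmod z0)%R; split; [fold r; lra |].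
        intros y Hy; assert (T := Cmod_triangle z0 (y - z0)).
        replace (z0 + (y - z0)) with y in T by ring; lra. }
      generalize (filter_and _ _ Hn Hd1); apply filter_imp.
      intros y [H1 H2]; rewrite Hgf by assumption; Cfield; exact H1.
    - exact (jet2_mult _ _ _ _ _ (jet2_id z0) (jet2_mult _ _ _ _ _ HG HG)). }
  assert (Hdv := jet2_has_cderiv _ _ _ _ Hfjet Hd).
  assert (Hg0n : g0 <> 0) by (apply Hgn; exact Hz0).
  assert (Hfz : f z0 = z0 * (g0 * g0)).
  { unfold g0; rewrite Hgf by assumption; field; exact Hz0n. }
  assert (Hw1 : 1 - w0 <> 0).
  { replace (1 - w0) with ((1 - b) * / (g0 + - b)) by (unfold w0, w; fold g0; ring).
    apply Cmult_neq_0; [exact Hb1 |].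
    intros H; apply C1_nz; rewrite <- (Cinv_r _ Hg0b), H; ring. }
  assert (Hg0w : g0 = (1 - b * w0) / (1 - w0)).
  { replace (1 - b * w0) with (g0 * (1 - w0)); [field; exact Hw1 |].
    unfold w0, w; fold g0; field; exact Hg0b. }
  assert (Hbw : 1 - b * w0 <> 0).
  { intros H; apply Hg0n; rewrite Hg0w, H; field; exact Hw1. }
  assert (HzG : z0 * G = kr * w0 * (1 - b) / ((1 - w0) * (1 - w0))).
  { replace (z0 * G) with (z0 * D * ((g0 + - b) * (g0 + - b)) / (1 - b))
      by (unfold D; field; now split).
    rewrite Hk, Hg0w; field; now split. }
  assert (HUval : U_f f z0 d =
    ((1 - w0) * (1 - w0) * (1 - b * w0) + 2 * kr * (1 - b) * w0 * (1 - w0)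
       - (1 - b * w0) * ((1 - b * w0) * (1 - b * w0)))
    / ((1 - b * w0) * ((1 - b * w0) * (1 - b * w0)))).
  { unfold U_f; rewrite Hdv, Hfz.
    (* [U_f = (g + 2 z g') / g^3 - 1], to be rewritten in terms of [w0] and [kr]. *)
    replace (z0 / (z0 * (g0 * g0)) * (z0 / (z0 * (g0 * g0))) *
      (1 * (g0 * g0) + z0 * (G * g0 + g0 * G)) - 1)
      with ((g0 + 2 * (z0 * G)) / (g0 * g0 * g0) - 1) by (field; now split).
    rewrite HzG, Hg0w; field; now split. }
  assert (Hnum := U_numerator_ge b kr w0 Hw0m ltac:(lra) Hkr).
  assert (Hden : (1 - b * w0) * ((1 - b * w0) * (1 - b * w0)) <> 0)
    by (now repeat apply Cmult_neq_0).
  rewrite HUval, Cmod_div in HUd by exact Hden.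
  assert (Hdp := proj1 (Cmod_gt_0 _) Hden).
  apply (Rmult_lt_compat_r _ _ _ Hdp) in HUd.
  unfold Rdiv in HUd; rewrite Rmult_assoc, Rinv_l, Rmult_1_r, Rmult_1_l in HUd by lra.
  lra.
Qed.

(* g is the branch of sqrt(f(z)/z) on D with g(0) = 1:
   continuous on D, g(z)^2 = f(z)/z for z <> 0, g(0) = 1. *)
Theorem theorem4p1 (f : C -> C) (a : nat -> C) (g : C -> C) :
  classU1 f a ->
  (forall z, in_disk z -> continuous g z) ->
  g 0 = 1 ->
  (forall z, in_disk z -> z <> 0 -> g z * g z = f z / z) ->
  forall z, in_disk z -> (Re (g z) > alpha (Cmod (a 2%nat)))%R.
Proof.
  intros HU Hg Hg0 Hgf z Hz.
  set (x := Cmod (a 2%nat)).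
  assert (Hx : (0 <= x)%R) by apply Cmod_ge_0.
  unfold alpha; set (S := sqrt (x * x + 40 * x + 16)).
  assert (HS : (S * S = x * x + 40 * x + 16)%R) by (apply sqrt_sqrt; nra).
  assert (HS0 : (0 <= S)%R) by apply sqrt_pos.
  destruct (Rle_lt_dec x 2) as [Hx2 | Hx2].
  - (* [x (1 + b) = 2 (1 - b) (1 - 3 b)] is the quadratic equation
       [12 alpha^2 - (20 + x) alpha + 8 = 0] solved by [alpha]. *)
    set (b := (2 * ((20 + x - S) / 24) - 1)%R).
    (* The end values are [b = 1 / 3] at [x = 0] and [b = 0] at [x = 2]. *)
    assert (Hb : (0 <= b <= 1 / 3)%R) by (unfold b; split; nra).
    assert (T := re_g_gt f a g b HU Hg Hg0 Hgf Hb).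
    replace ((20 + x - S) / 24)%R with ((1 + b) / 2)%R by (unfold b; field).
    apply T; [left | exact Hz]. fold x; unfold b; nra.
  - (* Here [alpha x <= 1 / 2], so [b = 0] suffices. *)
    assert (T := re_g_gt f a g 0 HU Hg Hg0 Hgf ltac:(lra) (or_intror eq_refl) z Hz).
    (* After squaring this reads [48 <= 24 x]. *)
    assert (x + 8 <= S)%R by nra. lra.
Qed.
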